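(* Let $M$ be a real hypersurface of a complex two-plane Grassmannian $G_2(\mathbb{C}^{m+2})$, with $n=4m-1$. Then: (a) The generalized normalized $\delta$-Casorati curvature $\delta_c(r,n-1)$ satisfies $$\rho \leq \frac{\delta_c(r,n-1)}{n(n-1)} + \frac{n+9}{n}$$ for any $r\in\mathbb{R}$ with $0<r<n(n-1)$. (b) The generalized normalized $\delta$-Casorati curvature $\widehat{\delta}_c(r,n-1)$ satisfies $$\rho \leq \frac{\widehat{\delta}_c(r,n-1)}{n(n-1)} + \frac{n+9}{n}$$ for any $r\in\mathbb{R}$ with $r>n(n-1)$. Moreover, the equalities hold in the relations of (a) and (b) if and only if $M$ is an invariantly quasi-umbilical submanifold with flat normal connection in $G_2(\mathbb{C}^{m+2})$ such that, with some orthonormal tangent frame $\{e_1,\dots,e_n\}$ of $TM$ and orthonormal normal frame $\{e_{n+1}=e\}$ of $TM^\perp$, the shape operator $A_e$ takes the following form $$A_e=\begin{pmatrix} a & 0 & \cdots & 0 & 0\\ 0 & a & \cdots & 0 & 0\\ \vdots & \vdots & \ddots & \vdots & \vdots\\ 0 & 0 & \cdots & a & 0\\ 0 & 0 & \cdots & 0 & \frac{n(n-1)}{r}a\end{pmatrix},$$ where $a$ denotes the common value of the first $n-1$ diagonal entries.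
   Context: Ambient space. $G_2(\mathbb{C}^{m+2})$ is the set of all complex 2-dimensional linear subspaces of $\mathbb{C}^{m+2}$, a Riemannian symmetric space of real dimension $4m$ with metric $g$, a Kähler structure $J$ and a quaternionic Kähler structure $E$ (a rank 3 subbundle of $\mathrm{End}(TG_2(\mathbb{C}^{m+2}))$) with $J\notin E$. Locally $E$ has a basis $\{J_1,J_2,J_3\}$ with $J_\alpha^2=-\mathrm{id}$, $J_\alpha J_{\alpha+1}=-J_{\alpha+1}J_\alpha=J_{\alpha+2}$ (indices mod 3), $g(J_\alpha X,J_\alpha Y)=g(X,Y)$, and $J_\alpha J=JJ_\alpha$. The Riemannian curvature tensor of $g$ is locally given by $$\overline{R}(X,Y)Z = g(Y,Z)X-g(X,Z)Y+g(JY,Z)JX-g(JX,Z)JY-2g(JX,Y)JZ$$ $$+\sum_{\alpha=1}^3\{g(J_\alpha Y,Z)J_\alpha X-g(J_\alpha X,Z)J_\alpha Y-2g(J_\alpha X,Y)J_\alpha Z\}+\sum_{\alpha=1}^3\{g(J_\alpha JY,Z)J_\alpha JX-g(J_\alpha JX,Z)J_\alpha JY\}.$$ Hypersurface. A real hypersurface $M$ is a submanifold of real codimension one, with the induced metric; $n=\dim M$. $R$ is the curvature tensor of $M$, $h$ its second fundamental form, $e$ a local unit normal vector field, $A_e$ the shape operator with respect to $e$, and, for a local orthonormal tangent frame $\{e_1,\dots,e_n\}$, $h_{ij}=g(h(e_i,e_j),e)$. Curvatures. With $K(e_i\wedge e_j)=g(R(e_i,e_j)e_j,e_i)$, the scalar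 curvature of $M$ is $\tau=\sum_{1\le i<j\le n}K(e_i\wedge e_j)$ and the normalized scalar curvature is $\rho=\frac{2\tau}{n(n-1)}$. The Casorati curvature is $C=\frac1n\|h\|^2=\frac1n\sum_{i,j=1}^n h_{ij}^2$. For a hyperplane $L\subset T_pM$ with orthonormal basis $\{e_1,\dots,e_{n-1}\}$, $C(L)=\frac1{n-1}\sum_{i,j=1}^{n-1}h_{ij}^2$. The generalized normalized $\delta$-Casorati curvatures are $$[\delta_c(r,n-1)](p)=rC(p)+\frac{(n-1)(n+r)(n^2-n-r)}{rn}\inf\{C(L)\mid L\text{ a hyperplane of }T_pM\},\quad 0<r<n^2-n,$$ $$[\widehat\delta_c(r,n-1)](p)=rC(p)-\frac{(n-1)(n+r)(r-n^2+n)}{rn}\sup\{C(L)\mid L\text{ a hyperplane of }T_pM\},\quad r>n^2-n.$$ Invariantly quasi-umbilical. A submanifold of dimension $n$ is invariantly quasi-umbilical if there exists a local orthonormal normal frame $\{e_\alpha\}$ such that the shape operators $A_{e_\alpha}$ have an eigenvalue of multiplicity $n-1$ for all $\alpha$ and the distinguished eigendirection of $A_{e_\alpha}$ is the same for each $\alpha$. The normal connection is flat if its curvature vanishes. *)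

(* Defs.v *)
From HB Require Import structures.
From mathcomp Require Import all_boot all_order all_algebra.
From mathcomp Require Import all_classical all_reals all_analysis.
From mathcomp Require Import complex.

Set Implicit Arguments.
Unset Strict Implicit.
Unset Printing Implicit Defensive.

Import Order.TTheory GRing.Theory Num.Theory.
Import numFieldNormedType.Exports.

Local Open Scope classical_set_scope.
Local Open Scope complex_scope.
Local Open Scope ring_scope.

(* A complex 2-plane of C^(m+2) is identified with the orthogonal projection
   onto it, so that G_2(C^(m+2)) is a set of Hermitian matrices, contained in a
   Euclidean space.  A real hypersurface is an immersed manifold of dimension
   n = 4m - 1, handled through its local parametrizations. *)

(* ** Differential calculus on open subsets of R^n *)

Section Calculus.
Context {R : realType} {n : nat}.

Definition pderiv (i : 'I_n) (f : 'rV[R]_n -> R) : 'rV[R]_n -> R :=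
  fun x => 'D_(delta_mx 0 i) f x.

Fixpoint Ck (k : nat) (U : set 'rV[R]_n) (f : 'rV[R]_n -> R) : Prop :=
  (forall x, U x -> {for x, continuous f}) /\
  if k is k'.+1 then
    forall i : 'I_n,
      (forall x, U x -> derivable f x (delta_mx 0 i)) /\ Ck k' U (pderiv i f)
  else True.

Definition smooth_on (U : set 'rV[R]_n) (f : 'rV[R]_n -> R) : Prop :=
  forall k, Ck k U f.

(* Complex matrices are viewed as real vectors, through the real and imaginary
   parts of their entries. *)

Definition smooth_mx_on {N : nat} (U : set 'rV[R]_n)
    (F : 'rV[R]_n -> 'M[R[i]]_N) : Prop :=
  forall a b, smooth_on U (fun x => complex.Re (F x a b)) /\
              smooth_on U (fun x => complex.Im (F x a b)).

Definition pderiv_mx {N : nat} (i : 'I_n) (F : 'rV[R]_n -> 'M[R[i]]_N) :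
    'rV[R]_n -> 'M[R[i]]_N :=
  fun x => \matrix_(a, b) (pderiv i (fun y => complex.Re (F y a b)) x
                        +i* pderiv i (fun y => complex.Im (F y a b)) x).

End Calculus.

(* ** The curvature tensor of a Riemannian metric in local coordinates *)

Section Riemann.
Context {R : realType} {n : nat}.
Variable g : 'rV[R]_n -> 'M[R]_n.

(* The component of \nabla_(d_i) d_j along d_k. *)
Definition christoffel (i j k : 'I_n) (x : 'rV[R]_n) : R :=
  2^-1 * \sum_l invmx (g x) k l *
    (pderiv i (fun y => g y j l) x + pderiv j (fun y => g y i l) x
     - pderiv l (fun y => g y i j) x).

(* The component of R(d_i, d_j) d_k along d_l, for the sign convention
   R(X, Y) = [\nabla_X, \nabla_Y] - \nabla_[X, Y]. *)
Definition riemann (i j k l : 'I_n) (x : 'rV[R]_n) : R :=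
  pderiv i (christoffel j k l) x - pderiv j (christoffel i k l) x
  + \sum_s (christoffel j k s x * christoffel i s l x
            - christoffel i k s x * christoffel j s l x).

(* g(R(X, Y) Z, W), for tangent vectors given by their coordinates. *)
Definition riemann4 (x : 'rV[R]_n) (X Y Z W : 'rV[R]_n) : R :=
  \sum_i \sum_j \sum_k \sum_l \sum_q
    X 0 i * Y 0 j * Z 0 k * riemann i j k l x * g x l q * W 0 q.

Definition sectional (x : 'rV[R]_n) (X Y : 'rV[R]_n) : R := riemann4 x X Y Y X.

(* The rows of E are the coordinates of the vectors of the frame. *)

Definition orthonormal {k : nat} (G : 'M[R]_n) (E : 'M[R]_(k, n)) : Prop :=
  E *m G *m E^T = 1%:M.

Definition scalar_curvature (x : 'rV[R]_n) (E : 'M[R]_n) : R :=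
  \sum_(i < n) \sum_(j < n | (i < j)%N) sectional x (row i E) (row j E).

Definition normalized_scalar_curvature (x : 'rV[R]_n) (E : 'M[R]_n) : R :=
  2 * scalar_curvature x E / (n%:R * (n%:R - 1)).

End Riemann.

(* ** Casorati curvatures
   G and H are the matrices of the metric and of the second fundamental form in
   the same basis of the tangent space. *)

Section Casorati.
Context {R : realType} {n : nat}.
Variables G H : 'M[R]_n.

(* (1/k) \sum h_ij^2 over the orthonormal family formed by the rows of B. *)
Definition casorati {k : nat} (B : 'M[R]_(k, n)) : R :=
  k%:R^-1 * \sum_(i < k) \sum_(j < k) ((B *m H *m B^T) i j) ^+ 2.

(* The numbers C(L); a hyperplane L is the row space of a matrix of rank n-1. *)
Definition hyperplane_casorati : set R :=
  [set c | exists L : 'M[R]_n, \rank L = n.-1 /\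
     exists B : 'M[R]_(n.-1, n),
       [/\ (B :=: L)%MS, orthonormal G B & c = casorati B]].

Definition delta_casorati (r : R) (E : 'M[R]_n) : R :=
  r * casorati E +
  (n%:R - 1) * (n%:R + r) * (n%:R ^+ 2 - n%:R - r) / (r * n%:R)
  * inf hyperplane_casorati.

Definition delta_hat_casorati (r : R) (E : 'M[R]_n) : R :=
  r * casorati E -
  (n%:R - 1) * (n%:R + r) * (r - n%:R ^+ 2 + n%:R) / (r * n%:R)
  * sup hyperplane_casorati.

End Casorati.

(* ** The complex two-plane Grassmannian *)

Section Grassmannian.
Context {R : realType} {N : nat}.
Implicit Types P X Y : 'M[R[i]]_N.

Definition adjmx X : 'M[R[i]]_N := (map_mx (@conjc R) X)^T.

Definition G2 : set 'M[R[i]]_N :=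
  [set P | [/\ adjmx P = P, P *m P = P & \rank P = 2%N]].

Definition tangentG2 P X : Prop := adjmx X = X /\ X = P *m X + X *m P.

(* The Riemannian metric of G_2.  It is real-valued on Hermitian matrices.  The
   factor 1/4 is the one for which the curvature tensor of g is
     g(Y,Z)X - g(X,Z)Y + g(JY,Z)JX - g(JX,Z)JY - 2g(JX,Y)JZ
     + \sum_a (g(J_a Y,Z)J_a X - g(J_a X,Z)J_a Y - 2g(J_a X,Y)J_a Z)
     + \sum_a (g(J_a J Y,Z)J_a J X - g(J_a J X,Z)J_a J Y),
   i.e. [[X, Y], Z] in terms of commutators of matrices: the maximal sectional
   curvature is 8. *)
Definition metricG2 X Y : R := complex.Re (\tr (X *m Y)) / 4.

(* The orthogonal projection of Hermitian matrices onto the tangent space. *)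
Definition projG2 P X : 'M[R[i]]_N :=
  P *m X *m (1%:M - P) + (1%:M - P) *m X *m P.

(* The Levi-Civita connection of G_2, as a Riemannian submanifold of the
   Euclidean space of Hermitian matrices: covariant derivative, in the i-th
   coordinate direction, of the field Y of vectors tangent to G_2 along F. *)
Definition covG2 {n} (F : 'rV[R]_n -> 'M[R[i]]_N) (i : 'I_n)
    (Y : 'rV[R]_n -> 'M[R[i]]_N) : 'rV[R]_n -> 'M[R[i]]_N :=
  fun x => projG2 (F x) (pderiv_mx i Y x).

End Grassmannian.

(* ** Immersed hypersurfaces of G_2, in a local parametrization F, with a unit
   normal vector field e along F *)

Section LocalHypersurface.
Context {R : realType} {n N : nat}.
Variable F : 'rV[R]_n -> 'M[R[i]]_N.

Definition immersion_at (x : 'rV[R]_n) : Prop :=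
  forall v : 'rV[R]_n,
    \sum_(i < n) (v 0 i)%:C *: pderiv_mx i F x = 0 -> v = 0.

Definition first_form (x : 'rV[R]_n) : 'M[R]_n :=
  \matrix_(i, j) metricG2 (pderiv_mx i F x) (pderiv_mx j F x).

Definition normal_at (x : 'rV[R]_n) (X : 'M[R[i]]_N) : Prop :=
  tangentG2 (F x) X /\ forall i : 'I_n, metricG2 X (pderiv_mx i F x) = 0.

Definition unit_normal_on (U : set 'rV[R]_n) (e : 'rV[R]_n -> 'M[R[i]]_N) :
    Prop :=
  smooth_mx_on U e /\
  forall x, U x -> normal_at x (e x) /\ metricG2 (e x) (e x) = 1.

Variable e : 'rV[R]_n -> 'M[R[i]]_N.

(* The normal part of a vector tangent to G_2, in codimension one. *)
Definition normal_part (x : 'rV[R]_n) (X : 'M[R[i]]_N) : 'M[R[i]]_N :=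
  (metricG2 X (e x))%:C *: e x.

(* h(d_i, d_j) *)
Definition second_form (i j : 'I_n) (x : 'rV[R]_n) : 'M[R[i]]_N :=
  normal_part x (covG2 F i (pderiv_mx j F) x).

Definition second_form_mx (x : 'rV[R]_n) : 'M[R]_n :=
  \matrix_(i, j) metricG2 (second_form i j x) (e x).

(* The shape operator, defined by g(A_e X, Y) = g(h(X, Y), e), as an operator
   on row vectors of coordinates. *)
Definition shape (x : 'rV[R]_n) : 'M[R]_n :=
  second_form_mx x *m invmx (first_form x).

Definition normal_conn (i : 'I_n) (xi : 'rV[R]_n -> 'M[R[i]]_N) :
    'rV[R]_n -> 'M[R[i]]_N :=
  fun x => normal_part x (covG2 F i xi x).

(* The shape operator is self-adjoint, so its eigenvalues have the same
   algebraic and geometric multiplicities; totally geodesic points are allowed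
   (multiplicity at least n - 1).  There is only one normal direction, hence no
   condition relating distinguished eigendirections. *)
Definition quasi_umbilical_at (x : 'rV[R]_n) : Prop :=
  exists a : R, (n.-1 <= \rank (eigenspace (shape x) a))%N.

(* In the orthonormal frame given by the rows of E, the matrix of A_e is
   diag(a, ..., a, n(n-1)/r a). *)
Definition shape_form_in (r : R) (x : 'rV[R]_n) (E : 'M[R]_n) : Prop :=
  orthonormal (first_form x) E /\
  exists a : R,
    E *m shape x =
    diag_mx (\row_(i < n) (if i == n.-1 :> nat
                           then n%:R * (n%:R - 1) / r * a else a)) *m E.

End LocalHypersurface.

(* ** Real hypersurfaces *)

Section Hypersurface.
Context {R : realType} {m : nat} {M : topologicalType}.
Variable f : M -> 'M[R[i]]_(m + 2).

Local Notation n := (4 * m - 1)%N.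

Definition local_param (U : set 'rV[R]_n) (phi : 'rV[R]_n -> M) : Prop :=
  [/\ open U,
      {in U &, injective phi},
      (forall x, U x -> {for x, continuous phi}),
      (forall V : set 'rV[R]_n, open V -> V `<=` U -> open (phi @` V)) &
      smooth_mx_on U (f \o phi) /\ (forall x, U x -> immersion_at (f \o phi) x)].

(* M is a manifold of dimension 4m - 1 immersed in G_2 by f.  The changes of
   coordinates between local parametrizations are automatically smooth, since
   f o phi is an immersion for each of them. *)
Definition real_hypersurface : Prop :=
  [/\ hausdorff_space M, @second_countable M,
      (forall p, G2 (f p)) &
      forall p, exists U phi, local_param U phi /\ (phi @` U) p].

Definition framed_param (U : set 'rV[R]_n) (phi : 'rV[R]_n -> M)
    (e : 'rV[R]_n -> 'M[R[i]]_(m + 2)) : Prop :=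
  local_param U phi /\ unit_normal_on (f \o phi) U e.

(* Around each point of M there is a local unit normal vector field e (a local
   orthonormal frame of the normal bundle) such that Q F e y holds at each point
   y of its domain.  Q is independent of the coordinates given by F. *)
Definition locally_for_some_normal
    (Q : forall F e : 'rV[R]_n -> 'M[R[i]]_(m + 2), 'rV[R]_n -> Prop) : Prop :=
  forall U phi, local_param U phi -> forall x, U x ->
  exists V e,
    [/\ open V, V `<=` U, V x, unit_normal_on (f \o phi) V e &
        forall y, V y -> Q (f \o phi) e y].

Definition invariantly_quasi_umbilical : Prop :=
  locally_for_some_normal quasi_umbilical_at.

Definition flat_normal_connection : Prop :=
  forall U phi e, framed_param U phi e ->
  forall xi : 'rV[R]_n -> 'M[R[i]]_(m + 2),
    smooth_mx_on U xi -> (forall x, U x -> normal_at (f \o phi) x (xi x)) ->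
  forall (i j : 'I_n) x, U x ->
    let D := normal_conn (f \o phi) e in D i (D j xi) x = D j (D i xi) x.

Definition shape_form (r : R) : Prop :=
  locally_for_some_normal
    (fun F e y => exists E : 'M[R]_n, shape_form_in F e r y E).

(* P rho delta delta_hat holds at every point of M, where rho, delta and
   delta_hat are the normalized scalar curvature and the two generalized
   normalized Casorati curvatures of M for the parameter r.  They are computed
   in arbitrary local coordinates, with an arbitrary local unit normal vector
   field (one exists around each point, as parametrizations can be restricted)
   and an arbitrary orthonormal tangent frame. *)
Definition at_every_point (r : R) (P : R -> R -> R -> Prop) : Prop :=
  forall U phi e, framed_param U phi e ->
  forall x, U x ->
  let G := first_form (f \o phi) in
  let H := second_form_mx (f \o phi) e in
  forall E : 'M[R]_n, orthonormal (G x) E ->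
    P (normalized_scalar_curvature G x E)
      (delta_casorati (G x) (H x) r E)
      (delta_hat_casorati (G x) (H x) r E).

End Hypersurface.

(* Main.v *)
(** The Gauss equation expresses the scalar curvature of M through the ambient
    curvature and the second fundamental form h.  G_2(C^(m+2)) is Einstein with
    Ricci curvature 4m + 8, so that twice the scalar curvature of M is
    (n - 1)(n + 9) + (tr h)^2 - |h|^2, and everything reduces to comparing
    (tr h)^2 - |h|^2 with r C + k C(L) for a hyperplane L, where k is the
    constant of the definition of the delta-Casorati curvatures.  Adapting an
    orthonormal frame to L makes the difference an explicit sum of squares,
    which vanishes exactly for the matrix diag(a, ..., a, n(n-1)/r a); the
    infimum and the supremum of C(L) are attained, by compactness of the set of
    orthonormal (n-1)-frames.

    In terms of projections, the complexified tangent space of G_2 at P is the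
    range of Y |-> P Y Q + Q Y P with Q = 1 - P, an orthogonal projection of
    trace 2 tr P tr Q = 4(N - 2) for N = m + 2.  Comparing traces shows that
    orthonormal tangent families of 4(N - 2) vectors are complete and that
    shorter ones can be extended; no explicit basis is needed. *)

Require Import Defs.
From mathcomp Require Import all_boot all_order all_algebra.
From mathcomp Require Import all_classical all_reals all_analysis.
From mathcomp Require Import complex.
From mathcomp Require Import ring lra zify.

Set Implicit Arguments.
Unset Strict Implicit.
Unset Printing Implicit Defensive.

Import Order.TTheory GRing.Theory Num.Theory.
Import numFieldNormedType.Exports.

Local Open Scope classical_set_scope.
Local Open Scope complex_scope.
Local Open Scope ring_scope.

Local Notation orthonormal := Defs.orthonormal.

(** * Orthonormal frames of a scalar product *)

(** The Riemann tensor of [M] is given by derivatives of the metric in coordinates, and [G_2] only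
    as a set of matrices, so no ambient curvature tensor is at hand. Everything is therefore
    immersed in the flat space of Hermitian matrices, where curvature is quadratic in the normal
    part of the second derivatives of [F]. That part is the sum of two second fundamental forms: the
    one of [M] in [G_2], and the one of [G_2] in flat space, which is [(1 - 2P)(XY + YX)] by
    differentiating [P P = P] twice. As [1 - 2P] acts isometrically here, the share of [G_2] is the
    trace polynomial [curvG2], whose sums over a frame follow from completeness of the frame. The
    inequality for a given hyperplane holds for every [r > 0]; the sign of [n(n-1) - r] only decides
    whether the infimum or the supremum of [C(L)] closes the equality case. Equality speaks of given
    unit normals, while the shape condition asks for one near each point. A smooth one is obtained
    by projecting a fixed Hermitian matrix, and two unit normals at a point differ by a sign, which
    [a] absorbs. *)

Definition pos_def (R : realType) n (G : 'M[R]_n) : Prop :=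
  G^T = G /\ forall v : 'rV[R]_n, v != 0 -> 0 < (v *m G *m v^T) 0 0.

Section Frames.
Context {R : realType} {n : nat}.
Variable G : 'M[R]_n.

Lemma orthonormal_row_free k (E : 'M[R]_(k, n)) :
  orthonormal G E -> row_free E.
Proof.
move=> EG; rewrite /row_free eqn_leq rank_leq_row/=.
apply: (leq_trans _ (mxrankM_maxl E (G *m E^T))).
by rewrite mulmxA EG mxrank1.
Qed.

Lemma orthonormal_cast p q (e : p = q) (E : 'M[R]_(p, n)) :
  orthonormal G E -> orthonormal G (castmx (e, erefl n) E).
Proof. by case: q / e; rewrite castmx_id. Qed.

Hypothesis G_pos : pos_def G.

Lemma pos_def_unit : G \in unitmx.
Proof.
case: G_pos => _ Gp; rewrite -row_free_unit -kermx_eq0.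
apply/negP => /negP/rowV0Pn[v /sub_kermxP vG v0].
by have := Gp _ v0; rewrite vG mul0mx mxE ltxx.
Qed.

(** The vectors orthogonal to the rows of [E] form the left kernel of [G *m E^T], which is nonzero
    because that matrix has only [k < n] columns. *)
Lemma orthonormal_extend k (E : 'M[R]_(k, n)) : orthonormal G E ->
  (k < n)%N -> exists u : 'rV[R]_n, orthonormal G (col_mx E u).
Proof.
move=> EG kn; case: G_pos => Gs Gp.
have : kermx (G *m E^T) != 0.
  rewrite -mxrank_eq0 mxrank_ker -lt0n subn_gt0.
  exact: leq_ltn_trans (rank_leq_col _) kn.
case/rowV0Pn => v /sub_kermxP; rewrite mulmxA => vGE v0.
set q := (v *m G *m v^T) 0 0; have q0 : 0 < q by apply: Gp.
have s0 : Num.sqrt q != 0 by rewrite gt_eqF// sqrtr_gt0.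
exists ((Num.sqrt q)^-1 *: v).
rewrite /orthonormal tr_col_mx mul_col_mx mul_col_row EG linearZ /=.
rewrite -!scalemxAl -!scalemxAr vGE scaler0 scalerA.
have -> : E *m G *m v^T = 0.
  by apply: trmx_inj; rewrite !trmx_mul trmxK Gs mulmxA vGE trmx0.
rewrite scaler0.
rewrite [v *m G *m v^T]mx11_scalar -/q scale_scalar_mx -invfM -expr2 sqr_sqrtr ?(ltW q0)//.
by rewrite mulVf ?gt_eqF// scalar_mx_block.
Qed.

Lemma orthonormal_exists k : (k <= n)%N ->
  exists E : 'M[R]_(k, n), orthonormal G E.
Proof.
elim: k => [_|k IH kn]; first by exists 0; apply/matrixP => -[].
have [E /orthonormal_extend/(_ kn)[u uE]] := IH (ltnW kn).
by exists (castmx (addn1 k, erefl n) (col_mx E u)); apply: orthonormal_cast.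
Qed.

(** A one-sided inverse of a square matrix is two-sided. This identity makes sums over an
    orthonormal frame independent of the frame. *)
Lemma orthonormal_full (E : 'M[R]_n) : orthonormal G E -> E^T *m E = invmx G.
Proof.
rewrite /orthonormal -mulmxA => /mulmx1C EG.
apply: (can_inj (mulKmx pos_def_unit)); rewrite mulmxV ?pos_def_unit//.
by rewrite mulmxA.
Qed.

Lemma orthonormal_full_cast p (e : n = p) (E : 'M[R]_(p, n)) :
  orthonormal G E -> E^T *m E = invmx G.
Proof. by case: p / e E => E; apply: orthonormal_full. Qed.

End Frames.

(** * The algebraic inequality *)

Section BlockIdentity.
Context {R : realType}.

Definition normsq p q (A : 'M[R]_(p, q)) : R := \sum_i \sum_j A i j ^+ 2.

Lemma normsq_ge0 p q (A : 'M[R]_(p, q)) : 0 <= normsq A.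
Proof. by do 2![apply: sumr_ge0 => ? _]; apply: sqr_ge0. Qed.

Lemma normsq_eq0 p q (A : 'M[R]_(p, q)) : normsq A = 0 -> A = 0.
Proof.
move=> /eqP; rewrite psumr_eq0; last first.
  by move=> i _; apply: sumr_ge0 => ? _; apply: sqr_ge0.
move=> /allP A0; apply/matrixP => i j; rewrite mxE.
have := A0 i (mem_index_enum _); rewrite implyTb psumr_eq0; last first.
  by move=> ? _; apply: sqr_ge0.
by move=> /allP/(_ j (mem_index_enum _)); rewrite implyTb sqrf_eq0 => /eqP.
Qed.

Lemma normsq_tr p q (A : 'M[R]_(p, q)) : normsq A = \tr (A *m A^T).
Proof.
apply: eq_bigr => i _; rewrite mxE; apply: eq_bigr => j _.
by rewrite mxE expr2.
Qed.

Lemma normsq_trmx p q (A : 'M[R]_(p, q)) : normsq A^T = normsq A.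
Proof. by rewrite !normsq_tr trmxK mxtrace_mulC. Qed.

Lemma normsq_block p q (A : 'M[R]_p) B C (D : 'M[R]_q) :
  normsq (block_mx A B C D) = normsq A + normsq B + (normsq C + normsq D).
Proof.
rewrite !normsq_tr tr_block_mx mulmx_block mxtrace_block !mxtraceD.
by ring.
Qed.

(** The defect of the Cauchy-Schwarz bound [(\tr A)^2 / k <= |A|^2] is a squared norm, so the case
    of equality can be read off. *)
Lemma normsq_sub_scalar k (A : 'M[R]_k) : (0 < k)%N ->
  normsq (A - (\tr A / k%:R)%:M) = normsq A - (\tr A) ^+ 2 / k%:R.
Proof.
move=> k0; have k0' : k%:R != 0 :> R by rewrite pnatr_eq0 -lt0n.
rewrite !normsq_tr raddfB /= tr_scalar_mx mulmxBl !mulmxBr !raddfB /=.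
rewrite mul_mx_scalar mul_scalar_mx !mxtraceZ mxtrace_tr -scalar_mxM.
rewrite mxtrace_scalar.
by field.
Qed.

Variables (k : nat) (r : R) (h : 'M[R]_(k + 1)).
Hypotheses (k0 : (0 < k)%N) (r0 : 0 < r) (h_sym : h^T = h).

Let n : R := k%:R + 1.
Let t : R := drsubmx h 0 0.
Let s : R := \tr (ulsubmx h).

(** [r C + c C(L) - ((tr h)^2 - |h|^2)] in a frame whose first [k = n - 1] vectors span [L]; the
    factor [n - 1] of the coefficient [c] has cancelled against the one in [C(L)]. *)
Let gap : R := r / n * normsq h
  + (n + r) * (n ^+ 2 - n - r) / (r * n) * normsq (ulsubmx h)
  - ((\tr h) ^+ 2 - normsq h).

Let n0 : 0 < n. Proof. by rewrite ltr_wpDl. Qed.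

(* The first two terms vanish for h = diag(a, ..., a, t), the last one forces
   n k a = r t. *)
Let gapE : gap = (n + r) * k%:R / r * normsq (ulsubmx h - (s / k%:R)%:M)
  + 2 * (n + r) / n * normsq (ursubmx h) + (n * s - r * t) ^+ 2 / (n * r).
Proof.
rewrite normsq_sub_scalar// /gap -/s.
have -> : \tr h = s + t by rewrite -[h]submxK mxtrace_block -/s trace_mx11.
have -> : normsq h = normsq (ulsubmx h) + 2 * normsq (ursubmx h) + t ^+ 2.
  rewrite -[h in LHS]submxK normsq_block.
  have -> : dlsubmx h = (ursubmx h)^T by rewrite trmx_ursub h_sym.
  have -> : normsq (drsubmx h) = t ^+ 2 by rewrite /normsq !big_ord1.
  by rewrite normsq_trmx; ring.
have k0' : k%:R != 0 :> R by rewrite pnatr_eq0 -lt0n.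
have n0' : n != 0 by rewrite gt_eqF.
have r0' : r != 0 by rewrite gt_eqF.
by rewrite /n in n0' *; field; rewrite k0' r0' n0'.
Qed.

Let coef1 : 0 < (n + r) * k%:R / r.
Proof. by rewrite !(mulr_gt0, addr_gt0, invr_gt0)// ltr0n. Qed.

Let coef2 : 0 < 2 * (n + r) / n.
Proof. by rewrite !(mulr_gt0, addr_gt0, invr_gt0)// ltr0n. Qed.

(** All three coefficients in [gapE] are positive for every [r > 0], whatever the sign of
    [n ^+ 2 - n - r]; hence one inequality serves both (a) and (b). *)
Lemma block_gap_ge0 : 0 <= gap.
Proof.
have nr0 : 0 < n * r by rewrite mulr_gt0.
rewrite gapE; apply: addr_ge0; last by rewrite divr_ge0 ?sqr_ge0// ltW.
by rewrite addr_ge0// mulr_ge0 ?normsq_ge0 ?(ltW coef1) ?(ltW coef2).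
Qed.

Lemma block_gap_eq0 : gap = 0 -> exists a : R,
  h = block_mx a%:M 0 0 (n * (n - 1) / r * a)%:M.
Proof.
have k0' : k%:R != 0 :> R by rewrite pnatr_eq0 -lt0n.
have r0' : r != 0 by rewrite gt_eqF.
have nr0 : 0 < n * r by rewrite mulr_gt0.
move=> /eqP; rewrite gapE paddr_eq0; first last.
- by rewrite divr_ge0 ?sqr_ge0// ltW.
- by rewrite addr_ge0// mulr_ge0 ?normsq_ge0 ?(ltW coef1) ?(ltW coef2).
rewrite paddr_eq0; first last.
- by rewrite mulr_ge0 ?normsq_ge0 ?(ltW coef2).
- by rewrite mulr_ge0 ?normsq_ge0 ?(ltW coef1).
rewrite (mulf_eq0 (_ * k%:R / r)) (mulf_eq0 (_ * _ / n)).
rewrite (gt_eqF coef1) (gt_eqF coef2)/=.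
rewrite mulf_eq0 invr_eq0 (gt_eqF nr0) orbF sqrf_eq0 subr_eq0.
move=> /andP[/andP[/eqP/normsq_eq0/eqP Ah /eqP/normsq_eq0 Bh] /eqP nt].
move: Ah; rewrite subr_eq0 => /eqP Ah.
(* The common value is the mean of the first [k] diagonal entries; [n s = r t] with [s = k a] and
   [k = n - 1] then fixes the last entry. *)
exists (s / k%:R); rewrite -[LHS]submxK -Ah Bh.
have -> : dlsubmx h = 0 by rewrite -h_sym -trmx_ursub Bh trmx0.
rewrite [drsubmx h]mx11_scalar -/t; congr (block_mx _ _ _ _%:M).
apply: (mulfI r0'); rewrite -nt /n.
by field; rewrite r0' k0'.
Qed.

Lemma block_gap_diag a :
  h = block_mx a%:M 0 0 (n * (n - 1) / r * a)%:M -> gap = 0.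
Proof.
have k0' : k%:R != 0 :> R by rewrite pnatr_eq0 -lt0n.
have r0' : r != 0 by rewrite gt_eqF.
have n0' : n != 0 by rewrite gt_eqF.
rewrite gapE /s /t => ->; rewrite block_mxKul block_mxKur block_mxKdr.
rewrite mxtrace_scalar -[a *+ k]mulr_natr mulfK// subrr.
have -> : normsq (0 : 'M[R]_k) = 0.
  by rewrite /normsq !big1// => i _; rewrite big1// => j _; rewrite mxE expr0n.
have -> : normsq (0 : 'M[R]_(k, 1)) = 0.
  by rewrite /normsq !big1// => i _; rewrite big1// => j _; rewrite mxE expr0n.
rewrite !mxE eqxx mulr1n !mulr0 !add0r /n in n0' *.
by field; rewrite r0' n0'.
Qed.

End BlockIdentity.

(** * Compactness of the set of orthonormal families *)

Section ContinuousMatrices.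
Context {R : realType} {T : topologicalType}.

Lemma eq_continuous_for (f g : T -> R) x :
  f =1 g -> {for x, continuous f} -> {for x, continuous g}.
Proof. by move=> /funext ->. Qed.

Lemma continuous_sumr I (s : seq I) (F : I -> T -> R) x :
  (forall i, {for x, continuous (F i)}) ->
  {for x, continuous (fun y => \sum_(i <- s) F i y)}.
Proof.
move=> cF; elim: s => [|i s IH].
  apply: (@eq_continuous_for (cst 0)) => [y|]; first by rewrite big_nil.
  exact: cst_continuous.
apply: (@eq_continuous_for (F i \+ fun y => \sum_(j <- s) F j y)) => [y|].
  by rewrite big_cons.
by apply: continuousD; [exact: cF|exact: IH].
Qed.

Definition continuous_mx p q (M : T -> 'M[R]_(p, q)) : Prop :=
  forall i j, continuous (fun x => M x i j).

Lemma continuous_mx_cst p q (A : 'M[R]_(p, q)) : continuous_mx (fun=> A).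
Proof. by move=> i j; apply: cst_continuous. Qed.

Lemma continuous_mx_tr p q (M : T -> 'M[R]_(p, q)) :
  continuous_mx M -> continuous_mx (fun x => (M x)^T).
Proof. by move=> cM i j x; apply: (eq_continuous_for _ (cM j i x)) => y; rewrite mxE. Qed.

Lemma continuous_mx_sub p q (M L : T -> 'M[R]_(p, q)) :
  continuous_mx M -> continuous_mx L -> continuous_mx (fun x => M x - L x).
Proof.
move=> cM cL i j x.
apply: (@eq_continuous_for ((fun y => M y i j) \- (fun y => L y i j))) => [y|].
  by rewrite !mxE.
by apply: continuousB; [exact: cM|exact: cL].
Qed.

Lemma continuous_mx_mul p q s (M : T -> 'M[R]_(p, q)) (L : T -> 'M[R]_(q, s)) :
  continuous_mx M -> continuous_mx L -> continuous_mx (fun x => M x *m L x).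
Proof.
move=> cM cL i j x.
apply: (@eq_continuous_for (fun y => \sum_k M y i k * L y k j)) => [y|].
  by rewrite mxE.
apply: continuous_sumr => k.
by apply: continuousM; [exact: cM|exact: cL].
Qed.

Lemma continuous_normsq p q (M : T -> 'M[R]_(p, q)) :
  continuous_mx M -> continuous (fun x => normsq (M x)).
Proof.
move=> cM x; rewrite /normsq.
apply: continuous_sumr => i; apply: continuous_sumr => j.
apply: (@eq_continuous_for ((fun y => M y i j) \* (fun y => M y i j))) => [y|].
  by rewrite expr2.
by apply: continuousM; exact: cM.
Qed.

End ContinuousMatrices.

Lemma continuous_vec_mx (R : realType) p q :
  continuous_mx (fun v : 'rV[R]_(p * q) => vec_mx v).
Proof.
move=> i j x; have := @coord_continuous R 1 (p * q) 0 (mxvec_index i j) x.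
by apply: eq_continuous_for => v; rewrite mxE.
Qed.

Section Stiefel.
Context {R : realType} {n k : nat}.
Variable G : 'M[R]_n.
Hypotheses (G_pos : pos_def G) (kn : (k <= n)%N).

(** In coordinates [C] relative to a fixed frame [E], orthonormality of [B] reads [C *m C^T = 1], so
    the entries of [C] are at most 1 in absolute value. *)
Lemma orthonormal_bounded : exists2 c : R, 0 <= c & forall B : 'M[R]_(k, n),
  orthonormal G B -> forall i j, `|B i j| <= c.
Proof.
have [E oE] := orthonormal_exists G_pos (leqnn n).
exists (\sum_i \sum_j `|E i j|) => [|B oB i j].
  by do 2![apply: sumr_ge0 => ? _].
pose C := B *m G *m E^T.
have BE : B = C *m E.
  by rewrite -mulmxA (orthonormal_full G_pos oE) mulmxK ?(pos_def_unit G_pos).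
have CC : C *m C^T = 1%:M.
  have [Gs _] := G_pos.
  rewrite !trmx_mul trmxK Gs !mulmxA -(mulmxA (B *m G)).
  rewrite (orthonormal_full G_pos oE) mulmxK ?(pos_def_unit G_pos)//.
clearbody C; have C1 l : `|C i l| <= 1.
  have : \sum_l C i l ^+ 2 = 1.
    have /matrixP/(_ i i) := CC; rewrite mxE [RHS]mxE eqxx mulr1n => <-.
    by apply: eq_bigr => a _; rewrite [in RHS]mxE expr2.
  rewrite (bigD1 l)//= => Cl; rewrite -(@ler_pXn2r _ 2)// ?nnegrE//.
  rewrite expr1n real_normK ?num_real// -Cl lerDl.
  by apply: sumr_ge0 => *; apply: sqr_ge0.
rewrite BE mxE (le_trans (ler_norm_sum _ _ _))//.
apply: ler_sum => l _; rewrite normrM.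
apply: le_trans (_ : `|E l j| <= _); first by rewrite ler_piMl.
by rewrite (bigD1 j)//= lerDl; apply: sumr_ge0.
Qed.

(** Families are flattened to row vectors, where bounded closed sets are compact; the set is closed
    as the zero set of the continuous function [Phi]. *)
Lemma orthonormal_compact :
  compact [set v : 'rV[R]_(k * n) | orthonormal G (vec_mx v)].
Proof.
apply: bounded_closed_compact.
  have [c c0 cB] := orthonormal_bounded.
  exists c; split; first exact: num_real.
  move=> d cd v /= /cB vc; rewrite /Num.norm /= mx_normrE.
  apply/bigmax_leP; split => [|[i j] _ /=].
    exact: le_trans c0 (ltW cd).
  rewrite (ord1 i) (le_trans _ (ltW cd))//.
  by case/mxvec_indexP: j => a b; have := vc a b; rewrite mxE.
pose Phi (v : 'rV[R]_(k * n)) : R :=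
  normsq (vec_mx v *m G *m (vec_mx v)^T - 1%:M : 'M[R]_k).
rewrite (_ : mkset _ = Phi @^-1` [set x | x = 0]).
  apply: preimage_closed; last exact: closed_eq.
  move=> v _; apply: continuous_normsq; apply: continuous_mx_sub; last first.
    exact: continuous_mx_cst.
  apply: continuous_mx_mul; last first.
    exact/continuous_mx_tr/continuous_vec_mx.
  apply: continuous_mx_mul; first exact: continuous_vec_mx.
  exact: continuous_mx_cst.
apply/seteqP; split => v /=; rewrite /orthonormal /Phi.
  move=> ->; rewrite subrr /normsq !big1// => *; rewrite big1// => *.
  by rewrite mxE expr0n.
by move=> /normsq_eq0/eqP; rewrite subr_eq0 => /eqP.
Qed.

Lemma orthonormal_extremal (H : 'M[R]_n) :
  exists B1 B2 : 'M[R]_(k, n), [/\ orthonormal G B1, orthonormal G B2 &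
    forall B : 'M[R]_(k, n), orthonormal G B ->
      normsq (B1 *m H *m B1^T) <= normsq (B *m H *m B^T) <=
      normsq (B2 *m H *m B2^T)].
Proof.
set A := [set v : 'rV[R]_(k * n) | orthonormal G (vec_mx v)].
pose Q (v : 'rV[R]_(k * n)) : R :=
  normsq (vec_mx v *m H *m (vec_mx v)^T : 'M[R]_k).
have cQ : {within A, continuous Q}.
  apply: continuous_subspaceT; apply: continuous_normsq.
  apply: continuous_mx_mul; last first.
    exact/continuous_mx_tr/continuous_vec_mx.
  apply: continuous_mx_mul; first exact: continuous_vec_mx.
  exact: continuous_mx_cst.
have A0 : A !=set0.
  have [B oB] := orthonormal_exists G_pos kn.
  by exists (mxvec B); rewrite /A /= mxvecK.
have [v1 /set_mem v1A v1P] := EVT_min_rV A0 orthonormal_compact cQ.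
have [v2 /set_mem v2A v2P] := EVT_max_rV A0 orthonormal_compact cQ.
exists (vec_mx v1), (vec_mx v2); split => // B oB.
have BA : mxvec B \in A by apply/mem_set; rewrite /A /= mxvecK.
by move: (v1P _ BA) (v2P _ BA); rewrite /Q mxvecK => -> ->.
Qed.

End Stiefel.

(** * Casorati curvatures of a symmetric form *)

Section CasoratiInequality.
Context {R : realType} {n : nat}.
Variables G H : 'M[R]_n.
Hypotheses (G_pos : pos_def G) (H_sym : H^T = H) (n_gt1 : (1 < n)%N).

(* (tr h)^2 - |h|^2 for the form h of matrix H, with indices raised by G^-1. *)
Definition extrinsic_scalar : R :=
  (\tr (H *m invmx G)) ^+ 2 - \tr (H *m invmx G *m (H *m invmx G)).

Lemma normsq_frame p (E : 'M[R]_(p, n)) : E^T *m E = invmx G ->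
  normsq (E *m H *m E^T) = \tr (H *m invmx G *m (H *m invmx G)).
Proof.
move=> EW; rewrite normsq_tr !trmx_mul trmxK H_sym.
by rewrite -!mulmxA mxtrace_mulC -!mulmxA (mulmxA E^T E) !EW.
Qed.

Lemma mxtrace_frame p (E : 'M[R]_(p, n)) : E^T *m E = invmx G ->
  \tr (E *m H *m E^T) = \tr (H *m invmx G).
Proof. by move=> EW; rewrite -mulmxA mxtrace_mulC -mulmxA EW. Qed.

Lemma casorati_frame (E : 'M[R]_n) : orthonormal G E ->
  casorati H E = n%:R^-1 * \tr (H *m invmx G *m (H *m invmx G)).
Proof. by move=> /(orthonormal_full G_pos) /normsq_frame <-. Qed.

Definition principal_form (r : R) (E : 'M[R]_n) (a : R) : Prop :=
  E *m (H *m invmx G) =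
  diag_mx (\row_(i < n) (if i == n.-1 :> nat
                         then n%:R * (n%:R - 1) / r * a else a)) *m E.

(** Block matrices have size [n.-1 + 1] and frames size [n]; the diagonal is a function on [nat] so
    that it survives the change of index type. *)
Lemma diag_form_cast p q (e : p = q) (E : 'M[R]_(p, n)) (S : 'M[R]_n)
    (d : nat -> R) :
  E *m S = diag_mx (\row_(i < p) d i) *m E ->
  castmx (e, erefl n) E *m S =
  diag_mx (\row_(i < q) d i) *m castmx (e, erefl n) E.
Proof. by case: q / e; rewrite castmx_id. Qed.

Lemma diag_mx_last k (a c : R) :
  diag_mx (\row_(i < k + 1) if i == k :> nat then c else a) =
  block_mx a%:M 0 0 c%:M.
Proof.
apply/matrixP => i j; rewrite !mxE.
case: splitP => i' ii'; rewrite !mxE; case: splitP => j' jj'; rewrite !mxE.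
- rewrite (_ : (i == j) = (i' == j')); last by rewrite -!val_eqE /= ii' jj'.
  by rewrite ii' ltn_eqF.
- rewrite (_ : (i == j) = false) ?mulr0n//; apply/negbTE.
  by rewrite -val_eqE /= ii' jj' neq_ltn ltn_addr.
- rewrite (_ : (i == j) = false) ?mulr0n//; apply/negbTE.
  by rewrite -val_eqE /= ii' jj' neq_ltn orbC ltn_addr.
- rewrite (_ : (i == j) = (i' == j')); last first.
    by rewrite -!val_eqE /= ii' jj' eqn_add2l.
  by rewrite ii' (ord1 i') addn0 eqxx.
Qed.

Variable r : R.
Hypothesis r_gt0 : 0 < r.

(* As functions of the extremal value c of C(L), both delta-Casorati curvatures
   are given by this formula; only the sign of the coefficient differs. *)
Definition delta_at (E : 'M[R]_n) (c : R) : R :=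
  r * casorati H E +
  (n%:R - 1) * (n%:R + r) * (n%:R ^+ 2 - n%:R - r) / (r * n%:R) * c.

Let k1 : (n.-1 + 1 = n)%N. Proof. by rewrite addn1 prednK// ltnW. Qed.
Let k0 : (0 < n.-1)%N. Proof. by rewrite -ltnS prednK// ltnW. Qed.
Let nE : n%:R = (n.-1)%:R + 1 :> R.
Proof. by rewrite -[in LHS]k1 natrD. Qed.

Let frame_block (B : 'M[R]_(n.-1, n)) (u : 'rV[R]_n) : let E := col_mx B u in
  ulsubmx (E *m H *m E^T) = B *m H *m B^T.
Proof. by rewrite /= tr_col_mx mul_col_mx mul_col_row block_mxKul. Qed.

(** The Casorati curvature and the extrinsic scalar are built from traces of [H *m invmx G] and its
    square, so they may be computed in the frame adapted to the hyperplane instead of [E]. *)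
Let frame_gap (E : 'M[R]_n) (B : 'M[R]_(n.-1, n)) (u : 'rV[R]_n) :
  orthonormal G E -> orthonormal G (col_mx B u) ->
  let h := col_mx B u *m H *m (col_mx B u)^T in
  delta_at E (casorati H B) - extrinsic_scalar =
  r / (n.-1%:R + 1) * normsq h +
  (n.-1%:R + 1 + r) * ((n.-1%:R + 1) ^+ 2 - (n.-1%:R + 1) - r) /
     (r * (n.-1%:R + 1)) * normsq (ulsubmx h)
  - ((\tr h) ^+ 2 - normsq h).
Proof.
move=> oE oBu h; rewrite /delta_at casorati_frame// /extrinsic_scalar /h.
have EW := orthonormal_full_cast G_pos (esym k1) oBu.
rewrite frame_block normsq_frame// mxtrace_frame// /casorati -/(normsq _) nE.
rewrite [_ + 1 - 1]addrK.
have k0' : (n.-1)%:R != 0 :> R by rewrite pnatr_eq0 -lt0n.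
have n0' : (n.-1)%:R + 1 != 0 :> R by rewrite -nE pnatr_eq0 -lt0n ltnW.
have r0' : r != 0 by rewrite gt_eqF.
by field; rewrite k0' n0' r0'.
Qed.

Let frame_sym p (E : 'M[R]_(p, n)) : (E *m H *m E^T)^T = E *m H *m E^T.
Proof. by rewrite !trmx_mul trmxK H_sym mulmxA. Qed.

Let extend (B : 'M[R]_(n.-1, n)) : orthonormal G B ->
  exists u : 'rV[R]_n, orthonormal G (col_mx B u).
Proof.
by move=> oB; apply: orthonormal_extend => //; rewrite prednK// ltnW.
Qed.

Lemma extrinsic_scalar_le (E : 'M[R]_n) (B : 'M[R]_(n.-1, n)) :
  orthonormal G E -> orthonormal G B ->
  extrinsic_scalar <= delta_at E (casorati H B).
Proof.
move=> oE oB; have [u oBu] := extend oB.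
rewrite -subr_ge0 (frame_gap oE oBu); apply: block_gap_ge0 => //.
Qed.

Lemma extrinsic_scalar_eq (E : 'M[R]_n) (B : 'M[R]_(n.-1, n)) :
  orthonormal G E -> orthonormal G B ->
  extrinsic_scalar = delta_at E (casorati H B) ->
  exists E' a, orthonormal G E' /\ principal_form r E' a.
Proof.
move=> oE oB; have [u oBu] := extend oB.
move=> /eqP; rewrite eq_sym -subr_eq0 (frame_gap oE oBu) => /eqP.
move=> /(block_gap_eq0 k0 r_gt0 (frame_sym _))[a ha].
exists (castmx (k1, erefl n) (col_mx B u)), a.
split; first exact: orthonormal_cast.
apply: (diag_form_cast k1 (d := fun i => if i == n.-1 then _ else a)).
rewrite diag_mx_last nE -ha -!mulmxA.
by rewrite (orthonormal_full_cast G_pos (esym k1) oBu).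
Qed.

(** The first [n - 1] principal vectors span a hyperplane at which the gap vanishes. *)
Lemma extrinsic_scalar_principal (E E' : 'M[R]_n) a :
  orthonormal G E -> orthonormal G E' -> principal_form r E' a ->
  exists2 B : 'M[R]_(n.-1, n), orthonormal G B &
    extrinsic_scalar = delta_at E (casorati H B).
Proof.
move=> oE oE' /(diag_form_cast (esym k1) (d := fun i => if i == n.-1 then _ else a)).
have := orthonormal_cast (esym k1) oE'.
set F := castmx _ _; rewrite -[F]vsubmxK.
set B := usubmx F; set u := dsubmx F => oBu; rewrite diag_mx_last => hF.
exists B.
  move: oBu; rewrite /orthonormal tr_col_mx mul_col_mx mul_col_row.
  by rewrite scalar_mx_block => /eq_block_mx[].
apply/eqP; rewrite eq_sym -subr_eq0 (frame_gap oE oBu); apply/eqP.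
apply: (@block_gap_diag _ _ r _ k0 r_gt0 (frame_sym _) a).
rewrite -[in LHS](mulmxKV (pos_def_unit G_pos) H) [in LHS]mulmxA hF -nE.
by rewrite -[RHS]mulmx1 -oBu !mulmxA.
Qed.

Lemma hyperplane_casoratiE : hyperplane_casorati G H =
  [set casorati H B | B in [set B : 'M[R]_(n.-1, n) | orthonormal G B]].
Proof.
apply/seteqP; split => [c /= [L [_ [B [_ oB ->]]]]|c /= [B oB <-]].
  by exists B.
exists <<B>>%MS; split.
  by rewrite mxrank_gen; apply/eqP: (orthonormal_row_free oB).
by exists B; split => //; apply/eqmx_sym/genmxE.
Qed.

Lemma casorati_extremal : exists B1 B2 : 'M[R]_(n.-1, n),
  [/\ orthonormal G B1, orthonormal G B2,
      forall B : 'M[R]_(n.-1, n), orthonormal G B ->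
        casorati H B1 <= casorati H B <= casorati H B2,
      inf (hyperplane_casorati G H) = casorati H B1 &
      sup (hyperplane_casorati G H) = casorati H B2].
Proof.
have [B1 [B2 [oB1 oB2 B12]]] := orthonormal_extremal G_pos (leq_pred n) H.
have k0' : 0 < (n.-1)%:R^-1 :> R by rewrite invr_gt0 ltr0n.
have C12 (B : 'M[R]_(n.-1, n)) : orthonormal G B ->
    casorati H B1 <= casorati H B <= casorati H B2.
  by move=> /B12; rewrite /casorati !ler_pM2l.
exists B1, B2; split => //; rewrite hyperplane_casoratiE.
- apply/eqP; rewrite eq_le; apply/andP; split.
    apply: ge_inf; last by exists B1.
    by exists (casorati H B1) => _ [B /C12/andP[? _] <-].
  apply: lb_le_inf; first by exists (casorati H B1); exists B1.
  by move=> _ [B /C12/andP[? _] <-].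
- apply/eqP; rewrite eq_le; apply/andP; split.
    apply: ge_sup; first by exists (casorati H B2); exists B2.
    by move=> _ [B /C12/andP[_ ?] <-].
  apply: ub_le_sup; last by exists B2.
  by exists (casorati H B2) => _ [B /C12/andP[_ ?] <-].
Qed.

Lemma delta_casoratiE E : delta_casorati G H r E =
  delta_at E (inf (hyperplane_casorati G H)).
Proof. by []. Qed.

Lemma delta_hat_casoratiE E : delta_hat_casorati G H r E =
  delta_at E (sup (hyperplane_casorati G H)).
Proof.
rewrite /delta_hat_casorati /delta_at; congr (_ + _).
by rewrite -!mulNr; congr (_ / _ * _); ring.
Qed.

Lemma extrinsic_scalar_le_delta E : orthonormal G E ->
  extrinsic_scalar <= delta_casorati G H r E.
Proof.
move=> oE; have [B [? [oB _ _ e _]]] := casorati_extremal.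
by rewrite delta_casoratiE e extrinsic_scalar_le.
Qed.

Lemma extrinsic_scalar_le_delta_hat E : orthonormal G E ->
  extrinsic_scalar <= delta_hat_casorati G H r E.
Proof.
move=> oE; have [? [B [_ oB _ _ e]]] := casorati_extremal.
by rewrite delta_hat_casoratiE e extrinsic_scalar_le.
Qed.

Let n1 : 0 < n%:R - 1 :> R. Proof. by rewrite subr_gt0 ltr1n. Qed.
Let n0 : 0 < n%:R :> R. Proof. by rewrite ltr0n ltnW. Qed.

Lemma extrinsic_scalar_eq_delta E : r < n%:R * (n%:R - 1) ->
  orthonormal G E ->
  extrinsic_scalar = delta_casorati G H r E <->
  exists E' a, orthonormal G E' /\ principal_form r E' a.
Proof.
move=> rn oE; have [B1 [B2 [oB1 _ B1P e _]]] := casorati_extremal.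
rewrite delta_casoratiE e; split => [|[E' [a [oE' pE']]]].
  exact: extrinsic_scalar_eq.
have [B oB Be] := extrinsic_scalar_principal oE oE' pE'.
apply/eqP; rewrite eq_le extrinsic_scalar_le//= Be lerD2l.
apply: ler_wpM2l; last by have /andP[] := B1P _ oB.
rewrite divr_ge0 ?mulr_ge0 ?(ltW n1) ?(ltW n0) ?(ltW r_gt0)//.
  by rewrite addr_ge0// ltW.
by rewrite subr_ge0; move: rn; rewrite mulrBr mulr1 expr2 => /ltW.
Qed.

(** The same squeeze with a nonpositive coefficient, so that now the supremum gives a value no
    larger than the one at the principal hyperplane. *)
Lemma extrinsic_scalar_eq_delta_hat E : n%:R * (n%:R - 1) < r ->
  orthonormal G E ->
  extrinsic_scalar = delta_hat_casorati G H r E <->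
  exists E' a, orthonormal G E' /\ principal_form r E' a.
Proof.
move=> rn oE; have [B1 [B2 [_ oB2 B2P _ e]]] := casorati_extremal.
rewrite delta_hat_casoratiE e; split => [|[E' [a [oE' pE']]]].
  exact: extrinsic_scalar_eq.
have [B oB Be] := extrinsic_scalar_principal oE oE' pE'.
apply/eqP; rewrite eq_le extrinsic_scalar_le//= Be lerD2l.
apply: ler_wnM2l; last by have /andP[] := B2P _ oB.
rewrite mulr_le0_ge0 ?invr_ge0 ?mulr_ge0 ?(ltW n0) ?(ltW r_gt0)//.
rewrite mulr_ge0_le0 ?mulr_ge0 ?(ltW n1)//.
  by rewrite addr_ge0// ltW.
by rewrite subr_le0; move: rn; rewrite mulrBr mulr1 expr2 => /ltW.
Qed.

End CasoratiInequality.

(** * Hermitian matrices *)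

Section Hermitian.
Context {R : realType} {N : nat}.
Local Notation C := R[i].
Implicit Types P X Y Z : 'M[C]_N.

Lemma adjmxM X Y : adjmx (X *m Y) = adjmx Y *m adjmx X.
Proof. by rewrite /adjmx map_mxM trmx_mul. Qed.

Lemma adjmxD X Y : adjmx (X + Y) = adjmx X + adjmx Y.
Proof. by rewrite /adjmx map_mxD linearD. Qed.

Lemma adjmxN X : adjmx (- X) = - adjmx X.
Proof. by rewrite /adjmx map_mxN linearN. Qed.

Lemma adjmxZ c X : adjmx (c *: X) = c^*%C *: adjmx X.
Proof. by rewrite /adjmx map_mxZ linearZ. Qed.

Lemma adjmx1 : adjmx (1%:M : 'M[C]_N) = 1%:M.
Proof. by rewrite /adjmx map_mx1 trmx1. Qed.

Lemma adjmx_delta i j : adjmx (delta_mx i j : 'M[C]_N) = delta_mx j i.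
Proof.
apply/matrixP => a b; rewrite !mxE andbC.
by case: (_ && _); rewrite ?conjc1 ?conjc0.
Qed.

Lemma adjmx_sum I (s : seq I) (F : I -> 'M[C]_N) :
  adjmx (\sum_(i <- s) F i) = \sum_(i <- s) adjmx (F i).
Proof.
by apply: (big_morph adjmx adjmxD); apply/matrixP => i j; rewrite !mxE conjc0.
Qed.

Lemma mxtrace_adj X : \tr (adjmx X) = (\tr X)^*%C.
Proof. by rewrite mxtrace_tr /mxtrace rmorph_sum; apply: eq_bigr => i _; rewrite mxE. Qed.

Lemma sqnormE X : \tr (X *m adjmx X) = \sum_i \sum_j X i j * (X i j)^*%C.
Proof.
apply: eq_bigr => i _; rewrite mxE; apply: eq_bigr => j _.
by rewrite !mxE.
Qed.

Lemma sqnorm_ge0 X : 0 <= \tr (X *m adjmx X).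
Proof. by rewrite sqnormE; do 2![apply: sumr_ge0 => ? _]; apply: mulcJ_ge0. Qed.

Lemma sqnorm_eq0 X : \tr (X *m adjmx X) = 0 -> X = 0.
Proof.
rewrite sqnormE => /eqP; rewrite psumr_eq0; last first.
  by move=> i _; apply: sumr_ge0 => ? _; apply: mulcJ_ge0.
move=> /allP X0; apply/matrixP => i j; rewrite mxE.
have := X0 i (mem_index_enum _); rewrite implyTb psumr_eq0; last first.
  by move=> ? _; apply: mulcJ_ge0.
move=> /allP/(_ j (mem_index_enum _)); rewrite implyTb mulf_eq0 conjc_eq0.
by case/orP => /eqP.
Qed.

(** The trace of a product of two Hermitian matrices equals its own conjugate. This is the passage
    between complex traces and the real metric. *)
Lemma metricG2E X Y : adjmx X = X -> adjmx Y = Y ->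
  \tr (X *m Y) = (4 * metricG2 X Y)%:C.
Proof.
move=> aX aY; rewrite /metricG2 mulrC divfK ?pnatr_eq0// RRe_real//.
have := mxtrace_adj (X *m Y); rewrite adjmxM aX aY mxtrace_mulC.
case: (\tr _) => a b [] /eqP; rewrite -addr_eq0 -mulr2n mulrn_eq0/= => /eqP ->.
by rewrite complex_real.
Qed.

Lemma metricG2C X Y : metricG2 X Y = metricG2 Y X.
Proof. by rewrite /metricG2 mxtrace_mulC. Qed.

Lemma ReD (x y : C) : complex.Re (x + y) = complex.Re x + complex.Re y.
Proof. by case: x y => [? ?] []. Qed.

Lemma ReMr (a : R) (x : C) : complex.Re (a%:C * x) = a * complex.Re x.
Proof. by case: x => ? ? /=; rewrite mul0r subr0. Qed.

Lemma metricG2Dl X Y Z : metricG2 (X + Y) Z = metricG2 X Z + metricG2 Y Z.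
Proof. by rewrite /metricG2 mulmxDl mxtraceD ReD mulrDl. Qed.

Lemma metricG2Zl a X Z : metricG2 (a%:C *: X) Z = a * metricG2 X Z.
Proof. by rewrite /metricG2 -scalemxAl mxtraceZ ReMr mulrA. Qed.

Lemma metricG2Dr X Y Z : metricG2 X (Y + Z) = metricG2 X Y + metricG2 X Z.
Proof. by rewrite metricG2C metricG2Dl !(metricG2C X). Qed.

Lemma metricG2Zr a X Z : metricG2 X (a%:C *: Z) = a * metricG2 X Z.
Proof. by rewrite metricG2C metricG2Zl metricG2C. Qed.

Lemma metricG20l X : metricG2 0 X = 0.
Proof. by rewrite /metricG2 mul0mx mxtrace0 mul0r. Qed.

Lemma metricG2Nl X Y : metricG2 (- X) Y = - metricG2 X Y.
Proof. by apply/eqP; rewrite -addr_eq0 -metricG2Dl addNr metricG20l. Qed.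

Lemma metricG2Nr X Y : metricG2 X (- Y) = - metricG2 X Y.
Proof. by rewrite metricG2C metricG2Nl metricG2C. Qed.

Lemma metricG2_suml I (s : seq I) (F : I -> 'M[C]_N) Y :
  metricG2 (\sum_(i <- s) F i) Y = \sum_(i <- s) metricG2 (F i) Y.
Proof.
by apply: (big_morph (metricG2^~ Y)) => [? ?|]; rewrite ?metricG2Dl ?metricG20l.
Qed.

Lemma metricG2_sumr I (s : seq I) (F : I -> 'M[C]_N) Y :
  metricG2 Y (\sum_(i <- s) F i) = \sum_(i <- s) metricG2 Y (F i).
Proof.
by rewrite metricG2C metricG2_suml; apply: eq_bigr => i _; rewrite metricG2C.
Qed.

Lemma mxtrace_sum I (s : seq I) (F : I -> 'M[C]_N) :
  \tr (\sum_(i <- s) F i) = \sum_(i <- s) \tr (F i).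
Proof. by rewrite raddf_sum. Qed.

Lemma metricG2_ge0 X : adjmx X = X -> 0 <= metricG2 X X.
Proof.
move=> aX; have := sqnorm_ge0 X; rewrite aX metricG2E// ler0c.
by rewrite pmulr_rge0// ltr0n.
Qed.

Lemma metricG2_eq0 X : adjmx X = X -> metricG2 X X = 0 -> X = 0.
Proof.
by move=> aX X0; apply: sqnorm_eq0; rewrite aX metricG2E// X0 mulr0.
Qed.

(** In a full-rank factorization [A = C *m B], idempotence forces [B *m C = 1], and the trace is
    cyclic. *)
Lemma mxtrace_idem (F : fieldType) (A : 'M[F]_N) :
  A *m A = A -> \tr A = (\rank A)%:R.
Proof.
move=> AA; have := mulmx_base A; have := col_base_full A.
have := row_base_free A; move: (row_base A) (col_base A) => B C fB fC CB.
rewrite -{1}CB mxtrace_mulC; suff -> : B *m C = 1%:M by rewrite mxtrace1.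
apply: (row_free_inj fB); apply: (row_full_inj fC).
by rewrite mul1mx !mulmxA CB -mulmxA CB.
Qed.

End Hermitian.

(** * Orthonormal families tangent to the Grassmannian *)

Section TangentFrames.
Context {R : realType} {N : nat}.
Local Notation C := R[i].
Variable P : 'M[C]_N.
Hypothesis P_G2 : G2 P.
Implicit Types X Y Z : 'M[C]_N.

Local Notation Q := (1%:M - P).

Let adjP : adjmx P = P. Proof. by case: P_G2. Qed.
Let PP : P *m P = P. Proof. by case: P_G2. Qed.
Let adjQ : adjmx Q = Q. Proof. by rewrite adjmxD adjmxN adjmx1 adjP. Qed.
Let QP : Q *m P = 0. Proof. by rewrite mulmxBl mul1mx PP subrr. Qed.
Let PQ : P *m Q = 0. Proof. by rewrite mulmxBr mulmx1 PP subrr. Qed.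
Let QQ : Q *m Q = Q. Proof. by rewrite mulmxBr mulmx1 QP subr0. Qed.
Let trP : \tr P = 2. Proof. by case: P_G2 => _ _ rP; rewrite mxtrace_idem// rP. Qed.
Let trQ : \tr Q = N%:R - 2.
Proof. by rewrite raddfB /= trP mxtrace1. Qed.

Lemma projG2D X Y : projG2 P (X + Y) = projG2 P X + projG2 P Y.
Proof.
rewrite /projG2; move: (1%:M - P) => Q'.
by rewrite !mulmxDr !mulmxDl addrACA.
Qed.

Lemma projG2Z c X : projG2 P (c *: X) = c *: projG2 P X.
Proof. by rewrite /projG2 -!scalemxAr -!scalemxAl scalerDr. Qed.

Lemma projG2_adj X : adjmx (projG2 P X) = projG2 P (adjmx X).
Proof. by rewrite /projG2 adjmxD !adjmxM adjP adjQ addrC !mulmxA. Qed.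

Lemma projG2_idem X : projG2 P (projG2 P X) = projG2 P X.
Proof.
move: PQ QP QQ; rewrite /projG2; move: (1%:M - P) => Q' PQ' QP' QQ'.
rewrite !mulmxDr !mulmxDl !mulmxA PP QQ' PQ' QP' !mul0mx addr0 add0r.
by rewrite -!mulmxA QQ' PP.
Qed.

(** Compressing [X = P X + X P] by [P] on both sides gives [P X P = 2 P X P], so [P X P = 0] and the
    two descriptions agree. *)
Lemma tangentG2_projP X :
  tangentG2 P X <-> adjmx X = X /\ projG2 P X = X.
Proof.
have tangP Y : P *m projG2 P Y + projG2 P Y *m P = projG2 P Y.
  move: PQ QP; rewrite /projG2; move: (1%:M - P) => Q' PQ' QP'.
  rewrite !mulmxDr !mulmxDl !mulmxA PP PQ' !mul0mx addr0.
  by rewrite -!mulmxA QP' PP !mulmx0 add0r.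
split=> [[aX XE]|[aX XE]]; split => //; last by rewrite -XE tangP.
have PXP : P *m X *m P = 0.
  have := congr1 (fun Y => P *m Y *m P) XE.
  rewrite /= mulmxDr mulmxDl !mulmxA PP -!mulmxA PP => /eqP.
  by rewrite -subr_eq0 opprD addrA subrr add0r oppr_eq0 => /eqP.
rewrite /projG2 mulmxBr mulmx1 PXP subr0 mulmxBl mul1mx mulmxBl PXP subr0.
by rewrite -XE.
Qed.

Lemma tangentG2_adj X : tangentG2 P X -> adjmx X = X.
Proof. by case. Qed.

Lemma tangentG2_proj X : tangentG2 P X -> projG2 P X = X.
Proof. by move=> /tangentG2_projP[]. Qed.

Lemma mxtrace_projG2 X Y : \tr (projG2 P X *m Y) = \tr (X *m projG2 P Y).
Proof.
rewrite /projG2; move: (1%:M - P) => Q'.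
rewrite mulmxDl mulmxDr !mxtraceD addrC; congr (_ + _).
  by rewrite -!mulmxA mxtrace_mulC -!mulmxA.
by rewrite -!mulmxA mxtrace_mulC -!mulmxA.
Qed.

Lemma metricG2_proj X Y : metricG2 (projG2 P X) Y = metricG2 X (projG2 P Y).
Proof. by rewrite /metricG2 mxtrace_projG2. Qed.

Definition tangent_frame (k : nat) (e : 'I_k -> 'M[C]_N) : Prop :=
  (forall a, tangentG2 P (e a)) /\
  forall a b, metricG2 (e a) (e b) = (a == b)%:R.

Section Frame.
Variables (k : nat) (e : 'I_k -> 'M[C]_N).
Hypothesis e_frame : tangent_frame e.

Let adj_e a : adjmx (e a) = e a.
Proof. by case: e_frame => /(_ a) /tangentG2_adj. Qed.

Let proj_e a : projG2 P (e a) = e a.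
Proof. by case: e_frame => /(_ a) /tangentG2_proj. Qed.

Let tr_e a b : \tr (e a *m e b) = 4 * (a == b)%:R.
Proof.
case: e_frame => _ ee; rewrite metricG2E ?adj_e// ee.
by rewrite rmorphM /= !rmorph_nat.
Qed.

(* tr (X Y) is 4 times the metric of G_2, whence the factor 1/4. *)
Definition frame_part Y := \sum_a (\tr (e a *m Y) / 4) *: e a.
(** Complex linear in [Y], since [frame_part] uses the complex trace; it can thus be tested on the
    elementary matrices [delta_mx i j], which are not Hermitian in general. *)
Definition frame_defect Y := projG2 P Y - frame_part Y.

Lemma frame_defectD X Y : frame_defect (X + Y) = frame_defect X + frame_defect Y.
Proof.
suff part_D : frame_part (X + Y) = frame_part X + frame_part Y.
  by rewrite /frame_defect projG2D part_D opprD addrACA.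
rewrite /frame_part -big_split /=; apply: eq_bigr => a _.
by rewrite -scalerDl mulmxDr mxtraceD mulrDl.
Qed.

Lemma frame_defectZ c X : frame_defect (c *: X) = c *: frame_defect X.
Proof.
rewrite /frame_defect projG2Z scalerBr; congr (_ - _).
rewrite /frame_part scaler_sumr; apply: eq_bigr => a _.
by rewrite scalerA -scalemxAr mxtraceZ mulrA.
Qed.

Lemma frame_defect_adj Y : adjmx (frame_defect Y) = frame_defect (adjmx Y).
Proof.
rewrite /frame_defect adjmxD adjmxN projG2_adj; congr (_ - _).
rewrite /frame_part adjmx_sum; apply: eq_bigr => a _.
rewrite adjmxZ adj_e rmorphM fmorphV rmorph_nat /= -mxtrace_adj adjmxM adj_e.
by rewrite mxtrace_mulC.
Qed.

Lemma frame_defect_orth Y a : \tr (e a *m frame_defect Y) = 0.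
Proof.
rewrite /frame_defect mulmxBr raddfB /= -mxtrace_projG2 proj_e.
rewrite /frame_part mulmx_sumr mxtrace_sum (bigD1 a)//= [X in _ - (_ + X)]big1.
  rewrite addr0 -scalemxAr mxtraceZ tr_e eqxx mulr1 divfK ?subrr//.
by move=> b ba; rewrite -scalemxAr mxtraceZ tr_e eq_sym (negbTE ba) !mulr0.
Qed.

Lemma frame_defect_proj Y : projG2 P (frame_defect Y) = frame_defect Y.
Proof.
suff pe : projG2 P (frame_part Y) = frame_part Y.
  by rewrite /frame_defect projG2D -scaleN1r projG2Z projG2_idem pe.
rewrite /frame_part; elim/big_ind: (X in projG2 P X = X) => [|A B IA IB|a _].
- by rewrite /projG2 mulmx0 !mul0mx mulmx0 mul0mx addr0.
- by rewrite projG2D IA IB.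
- by rewrite projG2Z proj_e.
Qed.

Lemma frame_defect_self X Y :
  \tr (frame_defect X *m frame_defect Y) = \tr (X *m frame_defect Y).
Proof.
rewrite {1}/frame_defect mulmxBl raddfB /= mxtrace_projG2 frame_defect_proj.
rewrite /frame_part mulmx_suml mxtrace_sum big1 ?subr0// => a _.
by rewrite -scalemxAl mxtraceZ frame_defect_orth mulr0.
Qed.

Lemma mxtrace_delta X i j : \tr (X *m delta_mx i j) = X j i.
Proof.
rewrite /mxtrace (bigD1 j)//= big1 => [|l lj].
  rewrite addr0 mxE (bigD1 i)//= big1 => [|l li]; first by rewrite mxE !eqxx mulr1 addr0.
  by rewrite mxE (negbTE li) mulr0.
by rewrite mxE big1// => l' _; rewrite mxE (negbTE lj) andbF mulr0.
Qed.

Lemma mulmx_delta X Y i j a b : (X *m delta_mx i j *m Y) a b = X a i * Y j b.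
Proof.
rewrite mxE (bigD1 j)//= big1 => [|l lj].
  rewrite addr0 mxE (bigD1 i)//= big1 => [|l li]; first by rewrite mxE !eqxx mulr1 addr0.
  by rewrite mxE (negbTE li) mulr0.
rewrite mxE big1 ?mul0r// => l' _; by rewrite mxE (negbTE lj) andbF mulr0.
Qed.

(* The orthogonal projection onto the complement of the frame in the tangent
   space has trace 4(N-2) - k, and the trace of an orthogonal projection is the
   sum of the squared norms of the images of an orthonormal basis. *)
Lemma frame_defect_trace :
  \sum_i \sum_j \tr (frame_defect (delta_mx i j) *m
                      adjmx (frame_defect (delta_mx i j))) =
  4 * (N%:R - 2) - k%:R.
Proof.
under eq_bigr => i _ do under eq_bigr => j _ do
  rewrite frame_defect_adj adjmx_delta frame_defect_self mxtrace_mulC mxtrace_delta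
    mxE [in X in X + _]mxE [X in _ + X]mxE summxE.
(* The trace of [Y |-> A Y B] is [tr A * tr B]. The pairs [P, Q] and [Q, P] contribute [2 (N - 2)]
   each, and every frame vector removes 1. *)
have trtr (A B : 'M[C]_N) :
    \sum_i \sum_j (A *m delta_mx j i *m B) j i = \tr A * \tr B.
  rewrite exchange_big mulr_suml; apply: eq_bigr => i _; rewrite mulr_sumr.
  by apply: eq_bigr => j _; rewrite mulmx_delta.
under eq_bigr do rewrite big_split /= big_split /=.
rewrite big_split /= big_split /= !trtr trP trQ.
have -> : \sum_i \sum_j - (\sum_a ((\tr (e a *m delta_mx j i) / 4) *: e a) j i)
    = - k%:R :> C.
  under eq_bigr do rewrite sumrN; rewrite sumrN; congr (- _).
  under eq_bigr do rewrite exchange_big /=; rewrite exchange_big /=.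
  rewrite (eq_bigr (fun=> 1)) => [|a _]; first by rewrite sumr_const card_ord.
  transitivity (\tr (e a *m e a) / 4); last first.
    by rewrite tr_e eqxx mulr1 divff// pnatr_eq0.
  rewrite mulr_suml; apply: eq_bigr => i _; rewrite mxE mulr_suml.
  by apply: eq_bigr => j _; rewrite mxE mxtrace_delta mulrAC.
set M : R[i] := N%:R - 2.
have -> : 4 = 2 + 2 :> R[i] by rewrite -natrD.
by rewrite (mulrDl 2 2 M) (mulrC M 2).
Qed.

Lemma frame_defect_sum I (s : seq I) (F : I -> 'M[C]_N) :
  frame_defect (\sum_(i <- s) F i) = \sum_(i <- s) frame_defect (F i).
Proof.
apply: (big_morph frame_defect frame_defectD).
by have := frame_defectZ 0 0; rewrite !scale0r.
Qed.

Lemma frame_defect_delta0 : (forall i j, frame_defect (delta_mx i j) = 0) ->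
  forall Y, frame_defect Y = 0.
Proof.
move=> d0 Y; rewrite [Y]matrix_sum_delta.
rewrite frame_defect_sum big1// => i _; rewrite frame_defect_sum big1// => j _.
by rewrite frame_defectZ d0 scaler0.
Qed.

(** The hypothesis reads [k = 4 (N - 2)]: the trace is zero, and it is a sum of squared norms of the
    values at the elementary matrices, which span. *)
Lemma frame_complete : (k + 8 = 4 * N)%N -> forall Y, projG2 P Y = frame_part Y.
Proof.
move=> kN Y; apply/eqP; rewrite -subr_eq0; apply/eqP.
apply: frame_defect_delta0 => i j; apply: sqnorm_eq0.
have /eqP : 4 * (N%:R - 2) - k%:R = 0 :> C.
  by rewrite mulrBr -!natrM -kN natrD addrK subrr.
rewrite -frame_defect_trace psumr_eq0; last first.
  by move=> a _; apply: sumr_ge0 => b _; apply: sqnorm_ge0.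
move=> /allP/(_ i (mem_index_enum _)); rewrite implyTb psumr_eq0; last first.
  by move=> b _; apply: sqnorm_ge0.
by move=> /allP/(_ j (mem_index_enum _)); rewrite implyTb => /eqP.
Qed.

(** Each [delta_mx i j] is a complex combination of the Hermitian matrices
    [delta_mx i j + delta_mx j i] and ['i *: (delta_mx i j - delta_mx j i)]. A defect vanishing on
    all Hermitian matrices would therefore vanish identically, against its positive trace. *)
Lemma frame_incomplete : (k + 8 < 4 * N)%N ->
  exists A, adjmx A = A /\ frame_defect A != 0.
Proof.
move=> kN; apply: contrapT => noA.
have herm0 A : adjmx A = A -> frame_defect A = 0.
  by move=> aA; apply: contrapT => /eqP dA; apply: noA; exists A.
have delta0 i j : frame_defect (delta_mx i j) = 0.
  have dD : frame_defect (delta_mx i j + delta_mx j i) = 0.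
    by apply: herm0; rewrite adjmxD !adjmx_delta addrC.
  have dB : frame_defect ('i%C *: (delta_mx i j - delta_mx j i)) = 0.
    apply: herm0; rewrite adjmxZ adjmxD adjmxN !adjmx_delta.
    have -> : ('i%C : C)^*%C = - 'i%C by apply/eqP; rewrite eq_complex /= oppr0 !eqxx.
    by rewrite scaleNr -scalerN opprB.
  have {}dB : frame_defect (delta_mx i j - delta_mx j i) = 0.
    have := congr1 (fun Y => - 'i%C *: Y) dB; rewrite /= scaler0 -frame_defectZ.
    by rewrite scalerA mulNr -expr2 sqr_i opprK scale1r.
  have := congr2 +%R dD dB; rewrite -frame_defectD addrACA subrr !addr0.
  rewrite -mulr2n -scaler_nat frame_defectZ => /eqP.
  by rewrite scaler_eq0 pnatr_eq0 => /eqP.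
have := frame_defect_trace.
rewrite big1 => [/esym/eqP|i _]; last first.
  by rewrite big1// => j _; rewrite delta0 mul0mx mxtrace0.
rewrite mulrBr -!natrM subr_eq0 subr_eq -natrD eqr_nat => /eqP kN'.
by move: kN; rewrite kN' ltnn.
Qed.

End Frame.

(* g(R(X, Y) Y, X) for the curvature tensor R(X, Y) Z = [[X, Y], Z] of G_2. *)
Definition curvG2 X Y : R :=
  2 * metricG2 (X *m X) (Y *m Y) - 2 * metricG2 (X *m Y) (X *m Y).

Lemma curvG2C X Y : curvG2 X Y = curvG2 Y X.
Proof.
rewrite /curvG2 metricG2C; congr (_ - 2 * _).
by rewrite /metricG2 -!mulmxA mxtrace_mulC -!mulmxA.
Qed.

Lemma curvG2xx X : curvG2 X X = 0.
Proof. by rewrite /curvG2 subrr. Qed.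

(** * Ricci curvature of the Grassmannian *)

Section FullFrame.
Variables (k : nat) (e : 'I_k -> 'M[C]_N).
Hypotheses (e_frame : tangent_frame e) (kN : (k + 8 = 4 * N)%N).

(** Completeness of the frame, read entry by entry on elementary matrices ([coef]) and contracted
    with [Z]. The factor 4 undoes the 1/4 of the metric. *)
Lemma frame_contraction Z :
  \sum_a e a *m Z *m e a = 4 *: (\tr (Q *m Z) *: P + \tr (P *m Z) *: Q).
Proof.
apply/matrixP => i l; rewrite summxE mxE [in X in _ * X]mxE.
rewrite [in X in _ * (X + _)]mxE [in X in _ * (_ + X)]mxE.
have coef b j : \sum_a e a i j * e a b l = 4 * (P i l * Q b j + Q i l * P b j).
  have /matrixP/(_ i j) := frame_complete e_frame kN (delta_mx l b).
  rewrite mxE !mulmx_delta => ->; rewrite summxE mulr_sumr.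
  apply: eq_bigr => a _; rewrite [in RHS]mxE mxtrace_delta mulrCA.
  by rewrite mulrA divfK ?pnatr_eq0// mulrC.
transitivity (\sum_b \sum_j \sum_a e a i j * e a b l * Z j b).
  under [RHS]eq_bigr do rewrite exchange_big; rewrite [RHS]exchange_big /=.
  apply: eq_bigr => a _; rewrite mxE.
  apply: eq_bigr => b _; rewrite mxE mulr_suml.
  by apply: eq_bigr => j _; rewrite mulrAC.
rewrite mulrDr !(mulrC (\tr _)) /mxtrace !mulr_sumr -big_split /=.
apply: eq_bigr => b _; rewrite [(Q *m Z) _ _]mxE [(P *m Z) _ _]mxE.
rewrite !mulr_sumr -big_split /=; apply: eq_bigr => j _.
rewrite -mulr_suml coef; move: (4 : C) => c.
by rewrite -mulrA mulrDl !mulrDr !mulrA.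
Qed.

(** For [Z = 1] the contraction gives [\sum_a e_a^2 = 4 ((N - 2) P + 2 Q)], and [P X^2], [Q X^2]
    each carry half the trace of [X^2]. For [Z = X] it gives 0, because [P X] and [Q X] are
    traceless. *)
Lemma ricciG2 X : tangentG2 P X ->
  \sum_a curvG2 (e a) X = 4 * N%:R * metricG2 X X.
Proof.
move=> tX; have [aX XE] := tX.
have half (y z : C) : z = y + y -> y = z / 2.
  by move=> ->; rewrite -mulr2n -(mulr_natr y 2) mulfK// pnatr_eq0.
have PX0 : \tr (P *m X) = 0.
  have := congr1 (fun Y => \tr (P *m Y)) XE.
  rewrite mulmxDr mulmxA PP mxtraceD [X in _ = _ + X]mxtrace_mulC -mulmxA PP.
  rewrite [X in _ = _ + X]mxtrace_mulC => /eqP.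
  by rewrite -subr_eq0 opprD addrA subrr sub0r oppr_eq0 => /eqP.
have X0 : \tr X = 0.
  by rewrite XE mxtraceD [\tr (X *m P)]mxtrace_mulC PX0 addr0.
have PXX : \tr (P *m (X *m X)) = \tr (X *m X) / 2.
  apply: half; rewrite {1}XE mulmxDl mxtraceD -mulmxA; congr (_ + _).
  by rewrite -mulmxA mxtrace_mulC -mulmxA.
have QXX : \tr (Q *m (X *m X)) = \tr (X *m X) / 2.
  rewrite mulmxBl mul1mx raddfB /= PXX; apply: (addIr (\tr (X *m X) / 2)).
  by rewrite subrK -splitr.
rewrite /curvG2 big_split /= sumrN -!mulr_sumr -metricG2_suml.
have -> : \sum_a e a *m e a = 4 *: ((N%:R - 2) *: P + 2 *: Q).
  have := frame_contraction 1%:M; rewrite !mulmx1 trP trQ => <-.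
  by apply: eq_bigr => a _; rewrite mulmx1.
have -> : \sum_a metricG2 (e a *m X) (e a *m X) = 0.
  transitivity (metricG2 (\sum_a e a *m X *m e a) X).
    by rewrite metricG2_suml; apply: eq_bigr => a _; rewrite /metricG2 !mulmxA.
  rewrite frame_contraction PX0 mulmxBl mul1mx raddfB /= PX0 X0 subrr !scale0r.
  by rewrite addr0 scaler0 metricG20l.
rewrite mulr0 subr0 /metricG2 -scalemxAl mulmxDl -!scalemxAl mxtraceZ mxtraceD.
rewrite !mxtraceZ PXX QXX -mulrDl subrK metricG2E//.
have nC j : j%:R = (j%:R)%:C :> C by rewrite rmorph_nat.
rewrite (nC 4) (nC N) (nC 2) -fmorphV -!rmorphM /=.
by field.
Qed.

End FullFrame.

Definition extend_frame n (e : 'I_n -> 'M[C]_N) (nu : 'M[C]_N) :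
    'I_n.+1 -> 'M[C]_N :=
  fun a => oapp e nu (unlift ord0 a).

Lemma extend_frameP n (e : 'I_n -> 'M[C]_N) nu :
  tangent_frame e -> tangentG2 P nu -> metricG2 nu nu = 1 ->
  (forall a, metricG2 nu (e a) = 0) -> tangent_frame (extend_frame e nu).
Proof.
move=> [te oe] tnu nu1 nue; split => [a|a b]; rewrite /extend_frame.
  by case: unliftP => [i _|_] /=.
case: (unliftP ord0 a) => [i ->|->]; case: (unliftP ord0 b) => [j ->|->] /=.
- by rewrite oe (inj_eq lift_inj).
- by rewrite metricG2C nue.
- by rewrite nue.
- by rewrite nu1.
Qed.

Lemma sum_extend_frame n (e : 'I_n -> 'M[C]_N) nu (V : zmodType)
    (f : 'M[C]_N -> V) :
  \sum_a f (extend_frame e nu a) = f nu + \sum_a f (e a).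
Proof.
rewrite big_ord_recl /extend_frame unlift_none /=; congr (_ + _).
by apply: eq_bigr => i _; rewrite liftK.
Qed.

(** Parseval's identity: [n + 9 = 4 * N] says that the frame together with [nu] has [4 (N - 2)]
    vectors, hence is complete. *)
Lemma hypersurface_complete n (e : 'I_n -> 'M[C]_N) nu :
  tangent_frame e -> tangentG2 P nu -> metricG2 nu nu = 1 ->
  (forall a, metricG2 nu (e a) = 0) -> (n + 9 = 4 * N)%N ->
  forall X Y, adjmx X = X -> adjmx Y = Y ->
  metricG2 (projG2 P X) Y =
  metricG2 X nu * metricG2 Y nu + \sum_a metricG2 X (e a) * metricG2 Y (e a).
Proof.
move=> fe tnu nu1 nue nN X Y aX aY.
have fE := extend_frameP fe tnu nu1 nue.
rewrite (frame_complete fE) ?addSnnS// /frame_part metricG2_suml.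
rewrite -(sum_extend_frame e nu (fun Z => metricG2 X Z * metricG2 Y Z)).
apply: eq_bigr => a _; have /tangentG2_adj aZ := fE.1 a.
rewrite metricG2E// (_ : _ / 4 = (metricG2 (extend_frame e nu a) X)%:C).
  by rewrite metricG2Zl metricG2C (metricG2C Y).
by rewrite rmorphM rmorph_nat mulrC mulKf// pnatr_eq0.
Qed.

(** Each inner sum is the Ricci constant [4 N = n + 9] minus the curvature of the plane containing
    [nu]; these corrections add up to the Ricci curvature of [nu], leaving [n - 1] copies of the
    constant. *)
Lemma sum_curvG2 n (e : 'I_n -> 'M[C]_N) nu :
  tangent_frame e -> tangentG2 P nu -> metricG2 nu nu = 1 ->
  (forall a, metricG2 nu (e a) = 0) -> (n + 9 = 4 * N)%N ->
  \sum_a \sum_b curvG2 (e a) (e b) = (n%:R - 1) * (n%:R + 9).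
Proof.
move=> fe tnu nu1 nue nN; have fE := extend_frameP fe tnu nu1 nue.
have nN' : (n.+1 + 8 = 4 * N)%N by rewrite addSnnS.
have ric X : tangentG2 P X ->
    \sum_a curvG2 X (e a) = 4 * N%:R * metricG2 X X - curvG2 X nu.
  move=> tX; rewrite -(ricciG2 fE nN' tX); under eq_bigr do rewrite curvG2C.
  rewrite (sum_extend_frame e nu (curvG2^~ X)) (curvG2C nu).
  by rewrite [curvG2 X nu + _]addrC addrK.
transitivity (\sum_a (4 * N%:R - curvG2 nu (e a))).
  by apply: eq_bigr => a _; rewrite (ric _ (fe.1 a)) fe.2 eqxx mulr1 curvG2C.
rewrite sumrB sumr_const card_ord ric// nu1 curvG2xx subr0 mulr1.
have -> : n%:R + 9 = 4 * N%:R :> R by rewrite -natrD nN natrM.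
by ring.
Qed.

End TangentFrames.

(** * Directional derivatives and functions of class C^k *)

Section Directional.
Context {R : realType} {V : normedModType R}.
Implicit Types (f : V -> R) (x v w : V).

Lemma is_derive_sumr I (s : seq I) (f : I -> V -> R) (df : I -> R) x v :
  (forall i, is_derive x v (f i) (df i)) ->
  is_derive x v (fun y => \sum_(i <- s) f i y) (\sum_(i <- s) df i).
Proof.
move=> fdf; elim: s => [|i s IH].
  rewrite big_nil (_ : (fun y => _) = cst 0); last first.
    by apply/funext => y; rewrite big_nil.
  exact: is_derive_cst.
rewrite big_cons (_ : (fun y => _) = f i + (fun y => \sum_(j <- s) f j y)).
  exact: is_deriveD.
by apply/funext => y; rewrite big_cons.
Qed.

Lemma growth_rate_shift f x v w :
  (fun h : R => h^-1 *: (((fun y => f (y + w)) \o shift x) (h *: v) - f (x + w))) =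
  (fun h : R => h^-1 *: ((f \o shift (x + w)) (h *: v) - f (x + w))).
Proof. by apply/funext => h /=; rewrite addrA. Qed.

Lemma derivable_translate f x v w :
  derivable f (x + w) v -> derivable (fun y => f (y + w)) x v.
Proof. by rewrite /derivable growth_rate_shift. Qed.

Lemma derive_translate f x v w : 'D_v (fun y => f (y + w)) x = 'D_v f (x + w).
Proof. by rewrite /derive growth_rate_shift. Qed.

Lemma growth_rate_line f x v (t : R) :
  (fun h : R => h^-1 *: (((fun a : R => f (x + a *: v)) \o shift t) (h *: 1) -
                         f (x + t *: v))) =
  (fun h : R => h^-1 *: ((f \o shift (x + t *: v)) (h *: v) - f (x + t *: v))).
Proof.
apply/funext => h /=; rewrite [h *: 1](mulr1 h) scalerDl.
by rewrite addrA [x + h *: v]addrC -addrA.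
Qed.

(** Restriction to a line gives access to the one-variable chain rule and mean value theorem. *)
Lemma is_derive_line f x v (t : R) : derivable f (x + t *: v) v ->
  is_derive t 1 (fun a : R => f (x + a *: v)) ('D_v f (x + t *: v)).
Proof.
move=> df; apply: DeriveDef; first by rewrite /derivable growth_rate_line.
by rewrite /derive growth_rate_line.
Qed.

Lemma is_derive_line0 f x v d :
  is_derive (0 : R) 1 (fun a : R => f (x + a *: v)) d -> is_derive x v f d.
Proof.
have := growth_rate_line f x v 0; rewrite scale0r addr0 => fE.
move=> [fd <-]; apply: DeriveDef.
  by move: fd; rewrite /derivable /= scale0r addr0 fE.
by rewrite /derive /= scale0r addr0 fE.
Qed.

Lemma is_derive_sqrt f x v : 0 < f x -> derivable f x v ->
  is_derive x v (fun y => Num.sqrt (f y)) ('D_v f x * (2 * Num.sqrt (f x))^-1).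
Proof.
move=> fx0 df; apply: is_derive_line0.
have df0 : is_derive (0 : R) 1 (fun a : R => f (x + a *: v)) ('D_v f x).
  by have := @is_derive_line f x v 0; rewrite scale0r addr0; apply.
have dsq : is_derive (f (x + (0 : R) *: v)) 1 (@Num.sqrt R) (2 * Num.sqrt (f x))^-1.
  by rewrite scale0r addr0; apply: is_derive1_sqrt.
rewrite mulrC; exact: is_derive1_comp dsq df0.
Qed.

Lemma derive_mvt f x v (s : R) : 0 < s ->
  (forall t, 0 <= t <= s -> derivable f (x + t *: v) v) ->
  exists2 t, 0 <= t <= s & f (x + s *: v) - f x = s * 'D_v f (x + t *: v).
Proof.
move=> s0 df.
have fd (t : R) : t \in `[0, s]%R ->
    is_derive t 1 (fun a : R => f (x + a *: v)) ('D_v f (x + t *: v)).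
  by rewrite in_itv /= => /df; exact: is_derive_line.
pose F (a : R) : R := f (x + a *: v); pose dF (t : R) : R := 'D_v f (x + t *: v).
have Fd (t : R) : t \in `]0, s[%R -> is_derive t 1 F (dF t).
  by move=> tP; apply: fd; apply: subset_itv_oo_cc tP.
have Fc : {within `[0, s], continuous F}.
  by apply: derivable_within_continuous => t /fd [].
have [t tP e] := MVT s0 Fd Fc.
exists t; first by have := subset_itv_oo_cc tP; rewrite in_itv.
by move: e; rewrite /F /dF scale0r addr0 subr0 mulrC.
Qed.

End Directional.

Section CkCalculus.
Context {R : realType} {n : nat}.
Local Notation V := 'rV[R]_n.
Implicit Types (U : set V) (f g : V -> R) (k : nat).

Lemma Ck_continuous k U f x : Ck k U f -> U x -> {for x, continuous f}.
Proof. by case: k => [|k] [fc _]; apply: fc. Qed.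

Lemma Ck_derivable k U f x i : Ck k.+1 U f -> U x -> derivable f x (delta_mx 0 i).
Proof. by move=> [_ /(_ i)[df _]]; apply: df. Qed.

Lemma Ck_pderiv k U f i : Ck k.+1 U f -> Ck k U (pderiv i f).
Proof. by move=> [_ /(_ i)[]]. Qed.

Lemma CkS k U f : Ck k.+1 U f -> Ck k U f.
Proof.
elim: k f => [|k IH] f [fc fd]; first by split.
by split => // i; have [? /IH] := fd i.
Qed.

Lemma Ck_subset k U W f : W `<=` U -> Ck k U f -> Ck k W f.
Proof.
move=> WU; elim: k f => [|k IH] f [fc fd]; split => //; try by move=> x /WU; apply: fc.
by move=> i; have [dfi /IH] := fd i; split => // x /WU; apply: dfi.
Qed.

Lemma nbhs_open_eq U f g x : open U -> (forall y, U y -> f y = g y) -> U x ->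
  {near x, f =1 g}.
Proof. by move=> oU fg Ux; near=> y; apply: fg; near: y; exact: open_nbhs_nbhs. 
Unshelve. all: by end_near. Qed.

Lemma near_eq_continuous f g x : {near x, f =1 g} ->
  {for x, continuous f} -> {for x, continuous g}.
Proof.
move=> fg fc; have fgx : f x = g x := nbhs_singleton fg.
have : f @ x --> g x by rewrite -fgx; exact: fc.
exact: cvg_trans (near_eq_cvg fg).
Qed.

Lemma Ck_eq k U f g : open U -> (forall x, U x -> f x = g x) ->
  Ck k U f -> Ck k U g.
Proof.
move=> oU; elim: k f g => [|k IH] f g fg [fc fd].
  by split => // x Ux; apply: near_eq_continuous (nbhs_open_eq oU fg Ux) (fc x Ux).
split=> [x Ux|i].
  exact: near_eq_continuous (nbhs_open_eq oU fg Ux) (fc x Ux).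
have [dfi dfk] := fd i; split => [x Ux|].
  exact: near_eq_derivable (nbhs_open_eq oU fg Ux) (dfi x Ux).
apply: IH dfk => x Ux; apply: near_eq_derive.
exact: nbhs_open_eq oU fg Ux.
Qed.

Lemma Ck_cst k U (c : R) : Ck k U (cst c).
Proof.
elim: k c => [|k IH] c; first by split => // x _; apply: cst_continuous.
split => [x _|i]; first exact: cst_continuous.
split => [x _|]; first exact: derivable_cst.
rewrite (_ : pderiv i _ = cst 0); first exact: IH.
by apply/funext => x; apply: derive_cst.
Qed.

Lemma Ck_add k U f g : open U -> Ck k U f -> Ck k U g ->
  Ck k U (fun x => f x + g x).
Proof.
move=> oU; elim: k f g => [|k IH] f g [fc fd] [gc gd].
  by split => // x Ux; apply: continuousD; [exact: fc|exact: gc].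
split => [x Ux|i]; first by apply: continuousD; [exact: fc|exact: gc].
have [dfi dfk] := fd i; have [dgi dgk] := gd i.
split => [x Ux|]; first exact: derivableD (dfi x Ux) (dgi x Ux).
apply: Ck_eq (IH _ _ dfk dgk) => // x Ux.
by rewrite /pderiv (deriveD (dfi x Ux) (dgi x Ux)).
Qed.

Lemma Ck_mul k U f g : open U -> Ck k U f -> Ck k U g ->
  Ck k U (fun x => f x * g x).
Proof.
move=> oU; elim: k f g => [|k IH] f g [fc fd] [gc gd].
  by split => // x Ux; apply: continuousM; [exact: fc|exact: gc].
split => [x Ux|i]; first by apply: continuousM; [exact: fc|exact: gc].
have [dfi dfk] := fd i; have [dgi dgk] := gd i.
split => [x Ux|]; first exact: derivableM (dfi x Ux) (dgi x Ux).
have Cf : Ck k U f by apply: CkS; split.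
have Cg : Ck k U g by apply: CkS; split.
apply: Ck_eq (Ck_add oU (IH _ _ Cf dgk) (IH _ _ Cg dfk)) => // x Ux.
by rewrite /pderiv (deriveM (dfi x Ux) (dgi x Ux)).
Qed.

(** The derivative [- f' / f^2] only involves [f'] and [1/f], and the latter is of class C^k by
    induction. *)
Lemma Ck_inv k U f : open U -> (forall x, U x -> f x != 0) -> Ck k U f ->
  Ck k U (fun x => (f x)^-1).
Proof.
move=> oU f0; elim: k => [|k IH] Cf.
  by split => // x Ux; apply: continuousV; [exact: f0|exact: Ck_continuous Cf Ux].
have Ck_f := CkS Cf; split => [x Ux|i].
  by apply: continuousV; [exact: f0|exact: Ck_continuous Cf Ux].
split => [x Ux|].
  by apply: derivableV; [exact: f0|exact: Ck_derivable Cf Ux].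
have Cinv := IH Ck_f.
have Cdf := Ck_mul oU (Ck_mul oU Cinv Cinv) (Ck_pderiv i Cf).
apply: Ck_eq (Ck_mul oU (Ck_cst k U (-1)) Cdf) => // x Ux.
rewrite [in RHS]/pderiv deriveV ?f0//; last exact: Ck_derivable Cf Ux.
by rewrite /= mulN1r scaleNr -expr2 exprVn.
Qed.

Lemma Ck_sqrt k U f : open U -> (forall x, U x -> 0 < f x) -> Ck k U f ->
  Ck k U (fun x => Num.sqrt (f x)).
Proof.
move=> oU f0.
have cont j x : Ck j U f -> U x -> {for x, continuous (fun x => Num.sqrt (f x))}.
  by move=> Cf Ux; apply: continuous_comp (Ck_continuous Cf Ux) _; apply: sqrt_continuous.
elim: k => [|k IH] Cf; first by split => // x; apply: cont Cf.
split => [x|i]; first exact: cont Cf.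
have dsqrt x (Ux : U x) := is_derive_sqrt (f0 x Ux) (Ck_derivable (i := i) Cf Ux).
split => [x Ux|]; first by have [] := dsqrt x Ux.
have sq0 x : U x -> 2 * Num.sqrt (f x) != 0.
  by move=> Ux; rewrite mulf_neq0 ?pnatr_eq0// gt_eqF// sqrtr_gt0 f0.
have Cinv := Ck_inv oU sq0 (Ck_mul oU (Ck_cst k U 2) (IH (CkS Cf))).
apply: Ck_eq (Ck_mul oU (Ck_pderiv i Cf) Cinv) => // x Ux.
by have [_ e] := dsqrt x Ux; rewrite [RHS]e.
Qed.

Lemma Ck_sum k U I (s : seq I) (F : I -> V -> R) : open U ->
  (forall i, Ck k U (F i)) -> Ck k U (fun x => \sum_(i <- s) F i x).
Proof.
move=> oU CF; elim: s => [|i s IH].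
  by apply: Ck_eq (Ck_cst k U 0) => // x _; rewrite big_nil.
by apply: Ck_eq (Ck_add oU (CF i) IH) => // x _; rewrite big_cons.
Qed.

Lemma Ck_prod k U I (s : seq I) (F : I -> V -> R) : open U ->
  (forall i, Ck k U (F i)) -> Ck k U (fun x => \prod_(i <- s) F i x).
Proof.
move=> oU CF; elim: s => [|i s IH].
  by apply: Ck_eq (Ck_cst k U 1) => // x _; rewrite big_nil.
by apply: Ck_eq (Ck_mul oU (CF i) IH) => // x _; rewrite big_cons.
Qed.

End CkCalculus.

Section Smooth.
Context {R : realType} {n : nat}.
Local Notation V := 'rV[R]_n.
Variable U : set V.
Hypothesis U_open : open U.
Implicit Types f g : V -> R.

Lemma smooth_on_eq f g : (forall x, U x -> f x = g x) ->
  smooth_on U f -> smooth_on U g.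
Proof. by move=> fg sf k; apply: Ck_eq fg (sf k). Qed.

Lemma smooth_on_cst (c : R) : smooth_on U (fun=> c).
Proof. by move=> k; apply: Ck_cst. Qed.

Lemma smooth_on_add f g : smooth_on U f -> smooth_on U g ->
  smooth_on U (fun x => f x + g x).
Proof. by move=> sf sg k; apply: Ck_add. Qed.

Lemma smooth_on_mul f g : smooth_on U f -> smooth_on U g ->
  smooth_on U (fun x => f x * g x).
Proof. by move=> sf sg k; apply: Ck_mul. Qed.

Lemma smooth_on_opp f : smooth_on U f -> smooth_on U (fun x => - f x).
Proof.
move=> sf; apply: smooth_on_eq (smooth_on_mul (smooth_on_cst (-1)) sf) => x _.
by rewrite mulN1r.
Qed.

Lemma smooth_on_sub f g : smooth_on U f -> smooth_on U g ->
  smooth_on U (fun x => f x - g x).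
Proof. by move=> sf sg; apply: smooth_on_add => //; apply: smooth_on_opp. Qed.

Lemma smooth_on_inv f : (forall x, U x -> f x != 0) -> smooth_on U f ->
  smooth_on U (fun x => (f x)^-1).
Proof. by move=> f0 sf k; apply: Ck_inv. Qed.

Lemma smooth_on_sqrt f : (forall x, U x -> 0 < f x) -> smooth_on U f ->
  smooth_on U (fun x => Num.sqrt (f x)).
Proof. by move=> f0 sf k; apply: Ck_sqrt. Qed.

Lemma smooth_on_sum I (s : seq I) (F : I -> V -> R) :
  (forall i, smooth_on U (F i)) -> smooth_on U (fun x => \sum_(i <- s) F i x).
Proof. by move=> sF k; apply: Ck_sum => // i; apply: sF. Qed.

Lemma smooth_on_pderiv i f : smooth_on U f -> smooth_on U (pderiv i f).
Proof. by move=> sf k; apply: Ck_pderiv (sf k.+1). Qed.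

Lemma smooth_on_continuous f x : smooth_on U f -> U x -> {for x, continuous f}.
Proof. by move=> sf; apply: Ck_continuous (sf 0%N). Qed.

Lemma smooth_on_derive i f x : smooth_on U f -> U x ->
  is_derive x (delta_mx 0 i) f (pderiv i f x).
Proof. by move=> sf Ux; apply: derivableP; apply: Ck_derivable (sf 1%N) Ux. Qed.

Lemma smooth_on_det p (A : V -> 'M[R]_p) :
  (forall i j, smooth_on U (fun x => A x i j)) ->
  smooth_on U (fun x => \det (A x)).
Proof.
move=> sA; apply: smooth_on_sum => s; apply: smooth_on_mul.
  exact: smooth_on_cst.
by move=> k; apply: Ck_prod => // i; apply: sA.
Qed.

(** By Cramer's rule, the entries are polynomials in those of [A x] divided by a nonvanishing
    determinant. *)
Lemma smooth_on_invmx p (A : V -> 'M[R]_p) :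
  (forall i j, smooth_on U (fun x => A x i j)) ->
  (forall x, U x -> A x \in unitmx) ->
  forall i j, smooth_on U (fun x => invmx (A x) i j).
Proof.
move=> sA uA i j.
apply: (@smooth_on_eq (fun x => (\det (A x))^-1 * cofactor (A x) j i)).
  by move=> x Ux; rewrite /invmx uA// !mxE.
apply: smooth_on_mul.
  apply: smooth_on_inv; last exact: smooth_on_det.
  by move=> x /uA; rewrite unitmxE unitfE.
apply: smooth_on_mul; first exact: smooth_on_cst.
apply: smooth_on_det => a b.
by apply: smooth_on_eq (sA (lift j a) (lift i b)) => x _; rewrite !mxE.
Qed.

End Smooth.

(** * Symmetry of second derivatives *)

Section SchwarzTheorem.
Context {R : realType} {n : nat}.
Local Notation V := 'rV[R]_n.

Lemma norm_delta_mx (i : 'I_n) : `|delta_mx 0 i : V| <= 1.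
Proof.
rewrite /Num.norm /= mx_normrE; apply/bigmax_leP; split => // -[a b] _ /=.
by rewrite mxE; case: (_ && _); rewrite ?normr1 ?normr0.
Qed.

(* Both mixed derivatives are limits of the second difference of f divided by
   the squared step, by two applications of the mean value theorem. *)
Lemma second_difference (U : set V) (f : V -> R) (i j : 'I_n) (x : V) (s : R) :
  0 < s -> (forall a b : R, 0 <= a <= s -> 0 <= b <= s ->
    U (x + a *: delta_mx 0 i + b *: delta_mx 0 j)) ->
  Ck 2 U f ->
  exists a b : R, [/\ 0 <= a <= s, 0 <= b <= s &
    f (x + s *: delta_mx 0 i + s *: delta_mx 0 j) - f (x + s *: delta_mx 0 i)
    - (f (x + s *: delta_mx 0 j) - f x) =
    s * (s * pderiv j (pderiv i f) (x + a *: delta_mx 0 i + b *: delta_mx 0 j))].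
Proof.
move=> s0 sU Cf; set u : V := delta_mx 0 i; set v : V := delta_mx 0 j.
have s00 : 0 <= (0 : R) <= s by rewrite lexx ltW.
have ss : 0 <= s <= s by rewrite lexx ltW.
pose g (y : V) : R := f (y + s *: v) - f y.
have dg (t : R) : 0 <= t <= s ->
    is_derive (x + t *: u) u g
      (pderiv i f (x + t *: u + s *: v) - pderiv i f (x + t *: u)).
  move=> ts; apply: is_deriveB.
    apply: DeriveDef; last exact: derive_translate.
    by apply: derivable_translate; apply: Ck_derivable Cf _; apply: sU.
  apply: derivableP; apply: Ck_derivable Cf _.
  by have := sU t 0 ts s00; rewrite scale0r addr0.
have [t ts e1] := derive_mvt s0 (fun t ts => @ex_derive _ _ _ _ _ _ _ (dg t ts)).
have [t' ts' e2] : exists2 t', 0 <= t' <= s &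
    pderiv i f (x + t *: u + s *: v) - pderiv i f (x + t *: u) =
    s * pderiv j (pderiv i f) (x + t *: u + t' *: v).
  apply: derive_mvt s0 _ => t' ts'.
  by apply: Ck_derivable (Ck_pderiv i Cf) _; apply: sU.
exists t, t'; split => //; rewrite -e2.
have [_ <-] := dg t ts; rewrite -e1 /g.
by [].
Qed.

Lemma pderiv_comm (U : set V) (f : V -> R) (i j : 'I_n) (x : V) :
  open U -> smooth_on U f -> U x ->
  pderiv i (pderiv j f) x = pderiv j (pderiv i f) x.
Proof.
move=> oU sf Ux; apply/eqP; rewrite -subr_eq0 -normr_le0; apply/ler_addgt0Pl => e e0.
have e2 : 0 < e / 2 by rewrite divr_gt0.
have near1 (a b : 'I_n) : \forall y \near x,
    `|pderiv a (pderiv b f) x - pderiv a (pderiv b f) y| < e / 2.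
  have c : {for x, continuous (pderiv a (pderiv b f))}.
    apply: smooth_on_continuous Ux.
    by do 2!apply: smooth_on_pderiv.
  by move/cvgrPdist_lt : c; apply.
have /nbhs_ballP[d /= d0 dP] : nbhs x (U `&` 
    ([set y | `|pderiv i (pderiv j f) x - pderiv i (pderiv j f) y| < e / 2] `&`
     [set y | `|pderiv j (pderiv i f) x - pderiv j (pderiv i f) y| < e / 2])).
  by apply: filterI; [exact: open_nbhs_nbhs|apply: filterI; exact: near1].
(* Steps of length at most [d / 4] in two directions stay within [d / 2] of [x]. *)
pose s := d / 4; have s0 : 0 < s by rewrite divr_gt0.
have inB (p q : 'I_n) (a b : R) : 0 <= a <= s -> 0 <= b <= s ->
    ball x d (x + a *: delta_mx 0 p + b *: delta_mx 0 q).
  move=> /andP[a0 as_] /andP[b0 bs].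
  rewrite -ball_normE /= -addrA opprD addNKr normrN.
  apply: le_lt_trans (ler_normD _ _) _; rewrite !normrZ !ger0_norm//.
  apply: (@le_lt_trans _ _ (s + s)).
    apply: lerD; (apply: le_trans (ler_wpM2l _ (norm_delta_mx _)) _; first by []);
      by rewrite mulr1.
  by rewrite /s; lra.
have sU (p q : 'I_n) (a b : R) : 0 <= a <= s -> 0 <= b <= s ->
    U (x + a *: delta_mx 0 p + b *: delta_mx 0 q).
  by move=> a_s b_s; have [] := dP _ (inB p q a b a_s b_s).
have [a [b [a_s b_s e1]]] := second_difference s0 (sU i j) (sf 2%N).
have [a' [b' [a_s' b_s' e3]]] := second_difference s0 (sU j i) (sf 2%N).
have [_ [_ /= h2]] := dP _ (inB i j a b a_s b_s).
have [_ [/= h1 _]] := dP _ (inB j i a' b' a_s' b_s').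
move: h1 h2 e1 e3; set D1 := pderiv i _ (_ + _); set D2 := pderiv j _ (_ + _).
(* The second difference is symmetric in the two directions, so the two mixed derivatives take the
   same value at two points close to [x]. *)
clearbody D1 D2 s => h1 h2 e1 e3; have D12 : D1 = D2.
  apply: (mulfI (lt0r_neq0 s0)); apply: (mulfI (lt0r_neq0 s0)).
  rewrite -e1 -e3 (addrAC x); move: (f _) (f _) (f _) (f _) => p q u v.
  by rewrite !opprB addrACA [- u - q]addrC addrACA.
rewrite addr0 -(subrKA D2); apply: le_trans (ler_normD _ _) _.
rewrite (distrC D2) -{1}D12 [leRHS]splitr.
by apply: lerD; exact: ltW.
Qed.

End SchwarzTheorem.

(** * Derivatives of matrix-valued functions *)

Section MatrixCalculus.
Context {R : realType} {n N : nat}.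
Local Notation C := R[i].
Local Notation V := 'rV[R]_n.
Implicit Types (F G : V -> 'M[C]_N) (X Y : 'M[C]_N).

Lemma ImD (x y : C) : complex.Im (x + y) = complex.Im x + complex.Im y.
Proof. by case: x y => [? ?] []. Qed.

Lemma Re_sum I (s : seq I) (f : I -> C) :
  complex.Re (\sum_(i <- s) f i) = \sum_(i <- s) complex.Re (f i).
Proof. exact: (big_morph _ ReD). Qed.

Lemma Im_sum I (s : seq I) (f : I -> C) :
  complex.Im (\sum_(i <- s) f i) = \sum_(i <- s) complex.Im (f i).
Proof. exact: (big_morph _ ImD). Qed.

Lemma ReM (x y : C) : complex.Re (x * y) =
  complex.Re x * complex.Re y - complex.Im x * complex.Im y.
Proof. by case: x y => [? ?] []. Qed.

Lemma ImM (x y : C) : complex.Im (x * y) =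
  complex.Re x * complex.Im y + complex.Im x * complex.Re y.
Proof. by case: x y => [? ?] []. Qed.

Definition is_pderiv_mx (i : 'I_n) F (x : V) (DF : 'M[C]_N) : Prop :=
  forall a b,
    is_derive x (delta_mx 0 i) (fun y => complex.Re (F y a b)) (complex.Re (DF a b)) /\
    is_derive x (delta_mx 0 i) (fun y => complex.Im (F y a b)) (complex.Im (DF a b)).

Lemma pderiv_mxE i F x DF : is_pderiv_mx i F x DF -> pderiv_mx i F x = DF.
Proof.
move=> dF; apply/matrixP => a b; rewrite mxE.
have [[_ re] [_ im]] := dF a b; rewrite /pderiv re im.
by case: (DF a b).
Qed.

Lemma smooth_is_pderiv_mx (U : set V) i F x : smooth_mx_on U F -> U x ->
  is_pderiv_mx i F x (pderiv_mx i F x).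
Proof.
move=> sF Ux a b; have [sre sim] := sF a b; rewrite mxE /=.
by split; apply: smooth_on_derive Ux.
Qed.

Lemma is_pderiv_mx_add i F G x DF DG :
  is_pderiv_mx i F x DF -> is_pderiv_mx i G x DG ->
  is_pderiv_mx i (fun y => F y + G y) x (DF + DG).
Proof.
move=> dF dG a b; have [? ?] := dF a b; have [? ?] := dG a b.
rewrite mxE ReD ImD; split.
  rewrite (_ : (fun y => _) = (fun y => complex.Re (F y a b)) +
    (fun y => complex.Re (G y a b))); first exact: is_deriveD.
  by apply/funext => y; rewrite mxE ReD.
rewrite (_ : (fun y => _) = (fun y => complex.Im (F y a b)) +
  (fun y => complex.Im (G y a b))); first exact: is_deriveD.
by apply/funext => y; rewrite mxE ImD.
Qed.

Lemma is_pderiv_mx_mul i F G x DF DG :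
  is_pderiv_mx i F x DF -> is_pderiv_mx i G x DG ->
  is_pderiv_mx i (fun y => F y *m G y) x (DF *m G x + F x *m DG).
Proof.
move=> dF dG a b; rewrite !mxE -big_split /=; split.
  rewrite (_ : (fun y => _) = (fun y => \sum_c
     (complex.Re (F y a c) * complex.Re (G y c b) -
      complex.Im (F y a c) * complex.Im (G y c b)))); last first.
    by apply/funext => y; rewrite mxE Re_sum; apply: eq_bigr => c _; rewrite ReM.
  rewrite Re_sum; apply: is_derive_sumr => c.
  have [r1 i1] := dF a c; have [r2 i2] := dG c b.
  apply: is_derive_eq (is_deriveB (is_deriveM r1 r2) (is_deriveM i1 i2)) _.
  by rewrite ReD !ReM /GRing.scale /=; ring.
rewrite (_ : (fun y => _) = (fun y => \sum_c
   (complex.Re (F y a c) * complex.Im (G y c b) +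
    complex.Im (F y a c) * complex.Re (G y c b)))); last first.
  by apply/funext => y; rewrite mxE Im_sum; apply: eq_bigr => c _; rewrite ImM.
rewrite Im_sum; apply: is_derive_sumr => c.
have [r1 i1] := dF a c; have [r2 i2] := dG c b.
apply: is_derive_eq (is_deriveD (is_deriveM r1 i2) (is_deriveM i1 r2)) _.
by rewrite ImD !ImM /GRing.scale /=; ring.
Qed.

Lemma is_pderiv_mx_adj i F x DF : is_pderiv_mx i F x DF ->
  is_pderiv_mx i (fun y => adjmx (F y)) x (adjmx DF).
Proof.
move=> dF a b; have [r1 i1] := dF b a; rewrite !mxE.
have Rec (z : C) : complex.Re (z^*%C) = complex.Re z by case: z.
have Imc (z : C) : complex.Im (z^*%C) = - complex.Im z by case: z.
rewrite Rec Imc; split.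
  rewrite (_ : (fun y => _) = (fun y => complex.Re (F y b a))) //.
  by apply/funext => y; rewrite !mxE Rec.
rewrite (_ : (fun y => _) = - (fun y => complex.Im (F y b a))).
  exact: is_deriveN.
by apply/funext => y; rewrite !mxE Imc.
Qed.

Lemma metricG2_entries X Y : metricG2 X Y =
  \sum_a \sum_b (complex.Re (X a b) * complex.Re (Y b a) -
                 complex.Im (X a b) * complex.Im (Y b a)) / 4.
Proof.
rewrite /metricG2 /mxtrace Re_sum mulr_suml; apply: eq_bigr => a _.
rewrite mxE Re_sum mulr_suml; apply: eq_bigr => b _.
by rewrite ReM.
Qed.

Lemma is_derive_metricG2 i F G x DF DG :
  is_pderiv_mx i F x DF -> is_pderiv_mx i G x DG ->
  is_derive x (delta_mx 0 i) (fun y => metricG2 (F y) (G y))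
    (metricG2 DF (G x) + metricG2 (F x) DG).
Proof.
move=> dF dG; rewrite (_ : (fun y => _) = (fun y =>
  \sum_a \sum_b (complex.Re (F y a b) * complex.Re (G y b a) -
                 complex.Im (F y a b) * complex.Im (G y b a)) / 4)); last first.
  by apply/funext => y; rewrite metricG2_entries.
rewrite !metricG2_entries -big_split; apply: is_derive_sumr => a.
rewrite -big_split; apply: is_derive_sumr => b.
have [r1 i1] := dF a b; have [r2 i2] := dG b a.
have d4 := is_derive_cst (4^-1 : R) x (delta_mx 0 i : V).
apply: is_derive_eq (is_deriveM (is_deriveB (is_deriveM r1 r2) (is_deriveM i1 i2)) d4) _.
by rewrite /GRing.scale /=; ring.
Qed.

Section SmoothMatrices.
Variable U : set V.
Hypothesis U_open : open U.

Lemma smooth_mx_cst X : smooth_mx_on U (fun=> X).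
Proof. by move=> a b; split; apply: smooth_on_cst. Qed.

Lemma smooth_mx_add F G : smooth_mx_on U F -> smooth_mx_on U G ->
  smooth_mx_on U (fun x => F x + G x).
Proof.
move=> sF sG a b; have [? ?] := sF a b; have [? ?] := sG a b; split.
  apply: (@smooth_on_eq _ _ _ U_open (fun y => complex.Re (F y a b) + complex.Re (G y a b))).
    by move=> y _; rewrite mxE ReD.
  exact: smooth_on_add.
apply: (@smooth_on_eq _ _ _ U_open (fun y => complex.Im (F y a b) + complex.Im (G y a b))).
  by move=> y _; rewrite mxE ImD.
exact: smooth_on_add.
Qed.

Lemma smooth_mx_mul F G : smooth_mx_on U F -> smooth_mx_on U G ->
  smooth_mx_on U (fun x => F x *m G x).
Proof.
move=> sF sG a b; split.
  apply: (@smooth_on_eq _ _ _ U_open (fun y => \sum_c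
     (complex.Re (F y a c) * complex.Re (G y c b) -
      complex.Im (F y a c) * complex.Im (G y c b)))).
    by move=> y _; rewrite mxE Re_sum; apply: eq_bigr => c _; rewrite ReM.
  apply: smooth_on_sum => // c; have [? ?] := sF a c; have [? ?] := sG c b.
  by apply: smooth_on_sub => //; apply: smooth_on_mul.
apply: (@smooth_on_eq _ _ _ U_open (fun y => \sum_c
   (complex.Re (F y a c) * complex.Im (G y c b) +
    complex.Im (F y a c) * complex.Re (G y c b)))).
  by move=> y _; rewrite mxE Im_sum; apply: eq_bigr => c _; rewrite ImM.
apply: smooth_on_sum => // c; have [? ?] := sF a c; have [? ?] := sG c b.
by apply: smooth_on_add => //; apply: smooth_on_mul.
Qed.

Lemma smooth_mx_scale (f : V -> R) F : smooth_on U f -> smooth_mx_on U F ->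
  smooth_mx_on U (fun x => (f x)%:C *: F x).
Proof.
move=> sf sF a b; have [sre sim] := sF a b; split.
  apply: smooth_on_eq (smooth_on_mul U_open sf sre) => // x _.
  by rewrite mxE ReMr.
apply: smooth_on_eq (smooth_on_mul U_open sf sim) => // x _.
by rewrite mxE; case: (F x a b) => ? ? /=; rewrite mul0r addr0.
Qed.

Lemma smooth_mx_sub F G : smooth_mx_on U F -> smooth_mx_on U G ->
  smooth_mx_on U (fun x => F x - G x).
Proof.
move=> sF sG; have := smooth_mx_add sF (smooth_mx_scale (smooth_on_cst U (-1)) sG).
rewrite (_ : (fun x => _) = (fun x => F x - G x))//.
by apply/funext => x; rewrite rmorphN rmorph1 scaleN1r.
Qed.

Lemma smooth_mx_sum I (s : seq I) (F : I -> V -> 'M[C]_N) :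
  (forall i, smooth_mx_on U (F i)) ->
  smooth_mx_on U (fun x => \sum_(i <- s) F i x).
Proof.
move=> sF; elim: s => [|i s IH].
  by under eq_fun do rewrite big_nil; apply: smooth_mx_cst.
by under eq_fun do rewrite big_cons; apply: smooth_mx_add.
Qed.

Lemma smooth_mx_pderiv i F : smooth_mx_on U F -> smooth_mx_on U (pderiv_mx i F).
Proof.
move=> sF a b; have [sre sim] := sF a b; split.
  apply: smooth_on_eq (smooth_on_pderiv i sre) => // x _.
  by rewrite mxE.
apply: smooth_on_eq (smooth_on_pderiv i sim) => // x _.
by rewrite mxE.
Qed.

Lemma smooth_on_metricG2 F G : smooth_mx_on U F -> smooth_mx_on U G ->
  smooth_on U (fun x => metricG2 (F x) (G x)).
Proof.
move=> sF sG; under eq_fun do rewrite metricG2_entries.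
apply: smooth_on_sum => // a; apply: smooth_on_sum => // b.
have [? ?] := sF a b; have [? ?] := sG b a.
apply: smooth_on_mul => //; last exact: smooth_on_cst.
by apply: smooth_on_sub => //; apply: smooth_on_mul.
Qed.

Lemma smooth_mx_subset (W : set V) F : W `<=` U -> smooth_mx_on U F ->
  smooth_mx_on W F.
Proof.
move=> WU sF a b; have [sre sim] := sF a b.
by split => k; [exact: Ck_subset (sre k)|exact: Ck_subset (sim k)].
Qed.

Lemma pderiv_mx_comm i j F x : smooth_mx_on U F -> U x ->
  pderiv_mx i (pderiv_mx j F) x = pderiv_mx j (pderiv_mx i F) x.
Proof.
move=> sF Ux; apply/matrixP => a b; have [sre sim] := sF a b; rewrite [LHS]mxE [RHS]mxE.
have E (k : 'I_n) : ((fun y => complex.Re (pderiv_mx k F y a b)) =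
                    pderiv k (fun y => complex.Re (F y a b))) *
                   ((fun y => complex.Im (pderiv_mx k F y a b)) =
                    pderiv k (fun y => complex.Im (F y a b))).
  by split; apply/funext => y; rewrite mxE.
rewrite (E i).1 (E i).2 (E j).1 (E j).2.
exact: (f_equal2 (@Complex R) (pderiv_comm i j U_open sre Ux)
                              (pderiv_comm i j U_open sim Ux)).
Qed.

Lemma pderiv_mx_eq i F G x : (forall y, U y -> F y = G y) -> U x ->
  pderiv_mx i F x = pderiv_mx i G x.
Proof.
move=> FG Ux; apply/matrixP => a b; rewrite !mxE /pderiv.
by congr Complex; apply: near_eq_derive; apply: (nbhs_open_eq U_open) => // y /FG ->.
Qed.

End SmoothMatrices.
End MatrixCalculus.

(** * The Gauss equation *)

Section SecondOrder.
Context {R : realType} {N : nat}.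
Local Notation C := R[i].
Implicit Types (P X Y S : 'M[C]_N).

Definition anticomm X Y : 'M[C]_N := X *m Y + Y *m X.

(** Tangent vectors exchange the range and the kernel of [P], so a product of two of them preserves
    both. *)
Lemma tangentG2_comm2 P X Y : P *m P = P ->
  X = P *m X + X *m P -> Y = P *m Y + Y *m P ->
  P *m (X *m Y) = X *m Y *m P.
Proof.
move=> PP XE YE.
have PX : P *m X = X - X *m P by rewrite {2}XE addrK.
have YP : Y *m P = Y - P *m Y by rewrite {2}YE addrAC subrr add0r.
by rewrite mulmxA PX mulmxBl -[RHS]mulmxA YP mulmxBr mulmxA.
Qed.

(** The second fundamental form of [G_2] in the flat space of Hermitian matrices. The hypothesis on
    [S] is [F *m F = F] differentiated twice. *)
Lemma second_derivative_normal P X Y S : G2 P -> tangentG2 P X ->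
  tangentG2 P Y -> S = S *m P + P *m S + anticomm X Y ->
  S - projG2 P S = (1%:M - P - P) *m anticomm X Y.
Proof.
move=> [_ PP _] [_ XE] [_ YE] SE.
have cT : P *m anticomm X Y = anticomm X Y *m P.
  by rewrite /anticomm mulmxDr mulmxDl !tangentG2_comm2.
move: (anticomm X Y) cT SE => T cT SE.
have PSP : P *m S *m P = - (P *m T).
  have /eqP : P *m S *m P = P *m S *m P + (P *m S *m P + P *m T).
    rewrite {1}SE !mulmxDr !mulmxDl !mulmxA PP -(mulmxA (P *m S) P P) PP.
    by rewrite -(mulmxA P T P) -cT mulmxA PP addrA.
  rewrite -subr_eq0 opprD addrA subrr sub0r oppr_eq0 addr_eq0.
  by move=> /eqP.
have ST : S - (S *m P + P *m S) = T by rewrite {1}SE addrC addKr.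
have -> : projG2 P S = S *m P + P *m S - (P *m S *m P + P *m S *m P).
  rewrite /projG2 mulmxBr mulmx1 mulmxBl mul1mx mulmxBl opprD addrACA.
  by rewrite [P *m S + _]addrC.
rewrite opprB addrCA addrC ST PSP -opprD !mulmxBl mul1mx.
by rewrite opprD addrA.
Qed.

(** The reflection [1 - 2P] squares to 1 and commutes with [X], so it drops out of the trace. *)
Lemma metricG2_reflect P X Y : P *m P = P ->
  P *m X = X *m P -> P *m Y = Y *m P ->
  metricG2 ((1%:M - P - P) *m X) ((1%:M - P - P) *m Y) = metricG2 X Y.
Proof.
move=> PP cX cY; set Z := 1%:M - P - P.
have ZZ : Z *m Z = 1%:M.
  rewrite /Z !mulmxBl !mul1mx !mulmxBr !mulmx1 PP subrr sub0r opprK.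
  by rewrite !subrK.
have cZ : Z *m X = X *m Z by rewrite /Z !mulmxBl !mulmxBr mul1mx mulmx1 cX.
by rewrite /metricG2 cZ -mulmxA (mulmxA Z) ZZ mul1mx.
Qed.

(** The Gauss equation of [G_2] in flat space, [g(II(X,X), II(Y,Y)) - g(II(X,Y), II(Y,X))], once the
    reflection in [II] has been removed. *)
Lemma curvG2_anticomm X Y :
  metricG2 (anticomm X X) (anticomm Y Y) - metricG2 (anticomm X Y) (anticomm Y X)
  = curvG2 X Y.
Proof.
have e1 : metricG2 (Y *m X) (X *m Y) = metricG2 (X *m X) (Y *m Y).
  by rewrite /metricG2 -!mulmxA mxtrace_mulC !mulmxA -mulmxA mxtrace_mulC !mulmxA.
have e2 : metricG2 (Y *m X) (Y *m X) = metricG2 (X *m Y) (X *m Y).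
  by rewrite /metricG2 -!mulmxA mxtrace_mulC !mulmxA.
rewrite /anticomm /curvG2 !(metricG2Dl, metricG2Dr) e1 e2.
rewrite [metricG2 (X *m Y) (Y *m X)]metricG2C e1.
by ring.
Qed.

End SecondOrder.

Lemma sum_offdiag (R : pzRingType) n (K : 'I_n -> 'I_n -> R) :
  (forall a b, K a b = K b a) -> (forall a, K a a = 0) ->
  \sum_a \sum_b K a b = 2 * \sum_(a < n) \sum_(b < n | (a < b)%N) K a b.
Proof.
move=> Ksym Kdiag; have -> : \sum_a \sum_b K a b =
    \sum_(a < n) (\sum_(b < n | (a < b)%N) K a b + \sum_(b < n | (b < a)%N) K a b).
  apply: eq_bigr => a _; rewrite (bigID (fun b : 'I_n => (a < b)%N)) /=.
  congr (_ + _); rewrite (bigD1 a) ?ltnn//= Kdiag add0r.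
  by apply: eq_bigl => b; rewrite -leqNgt andbC -ltn_neqAle.
rewrite big_split /= [X in _ + X](exchange_big_dep xpredT) //=.
under [X in _ + X]eq_bigr do under eq_bigr do rewrite Ksym.
by rewrite mulr_natl mulr2n.
Qed.

(** * Intrinsic curvature of an immersion into the flat space of Hermitian matrices *)

Section LocalGeometry.
Context {R : realType} {n N : nat}.
Local Notation C := R[i].
Local Notation V := 'rV[R]_n.
Variables (U : set V) (F : V -> 'M[C]_N).
Hypotheses (U_open : open U) (F_smooth : smooth_mx_on U F).
Hypotheses (F_G2 : forall x, G2 (F x)).
Hypothesis F_imm : forall x, U x -> immersion_at F x.

Local Notation dF i := (pderiv_mx i F).
Local Notation ddF i j := (pderiv_mx i (pderiv_mx j F)).
Local Notation g := (first_form F).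

Let is_dF i x : U x -> is_pderiv_mx i F x (dF i x).
Proof. exact: smooth_is_pderiv_mx. Qed.

Let dF_smooth i : smooth_mx_on U (dF i).
Proof. exact: smooth_mx_pderiv. Qed.

Let is_ddF i j x : U x -> is_pderiv_mx i (dF j) x (ddF i j x).
Proof. exact: smooth_is_pderiv_mx. Qed.

Lemma dF_tangent i x : U x -> tangentG2 (F x) (dF i x).
Proof.
move=> Ux; split.
  rewrite -(pderiv_mxE (is_pderiv_mx_adj (is_dF i Ux))); congr pderiv_mx.
  by apply/funext => y; have [] := F_G2 y.
have := pderiv_mxE (is_pderiv_mx_mul (is_dF i Ux) (is_dF i Ux)).
rewrite (_ : (fun y => _) = F) => [{1}->|]; first by rewrite addrC.
by apply/funext => y; have [] := F_G2 y.
Qed.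

Lemma ddF_adj i j x : U x -> adjmx (ddF i j x) = ddF i j x.
Proof.
move=> Ux; rewrite -(pderiv_mxE (is_pderiv_mx_adj (is_ddF i j Ux))).
apply: (pderiv_mx_eq U_open) => // y Uy.
by have [] := dF_tangent j Uy.
Qed.

Lemma ddF_sym i j x : U x -> ddF i j x = ddF j i x.
Proof. exact: pderiv_mx_comm. Qed.

(** The derivative of the tangency relation for [pderiv_mx j F]; it provides the hypothesis on [S]
    in [second_derivative_normal]. *)
Lemma ddF_decomp i j x : U x ->
  ddF i j x = ddF i j x *m F x + F x *m ddF i j x + anticomm (dF i x) (dF j x).
Proof.
move=> Ux; have := is_pderiv_mx_add (is_pderiv_mx_mul (is_dF i Ux) (is_ddF i j Ux))
  (is_pderiv_mx_mul (is_ddF i j Ux) (is_dF i Ux)).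
move/pderiv_mxE => e.
transitivity (pderiv_mx i (fun y => F y *m dF j y + dF j y *m F y) x).
  apply: (pderiv_mx_eq U_open) => // y Uy.
  by have [_ {1}->] := dF_tangent j Uy.
rewrite e /anticomm addrC -!addrA; congr (_ + _).
by rewrite addrC -!addrA addrCA.
Qed.

Definition push x (v : V) : 'M[C]_N := \sum_i (v 0 i)%:C *: dF i x.

(** Second derivative of [F] along constant coordinate vectors. It depends on the coordinates, but
    its part orthogonal to the image of [dF] is the second fundamental form in flat space. *)
Definition push2 x (v w : V) : 'M[C]_N :=
  \sum_i (v 0 i)%:C *: \sum_j (w 0 j)%:C *: ddF i j x.

Lemma push_tangent x v : U x -> tangentG2 (F x) (push x v).
Proof.
move=> Ux; split.
  rewrite /push adjmx_sum; apply: eq_bigr => i _.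
  by rewrite adjmxZ conjc_real; have [->] := dF_tangent i Ux.
rewrite /push mulmx_sumr mulmx_suml -big_split; apply: eq_bigr => i _ /=.
rewrite -scalemxAr -scalemxAl -scalerDr.
by have [_ <-] := dF_tangent i Ux.
Qed.

Lemma metricG2_push x (v : V) X :
  metricG2 X (push x v) = \sum_i v 0 i * metricG2 X (dF i x).
Proof. by rewrite metricG2_sumr; apply: eq_bigr => i _; rewrite metricG2Zr. Qed.

Lemma first_form_push x (v w : V) :
  metricG2 (push x v) (push x w) = (v *m g x *m w^T) 0 0.
Proof.
rewrite metricG2_push mxE; apply: eq_bigr => j _; rewrite [in RHS]mxE.
rewrite metricG2C metricG2_push mulrC [in RHS]mxE; congr (_ * _).
by apply: eq_bigr => i _; rewrite [in RHS]mxE metricG2C.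
Qed.

Lemma first_form_pos_def x : U x -> pos_def (g x).
Proof.
move=> Ux; split; first by apply/matrixP => i j; rewrite !mxE metricG2C.
move=> v v0; rewrite -first_form_push lt0r.
have [aP _] := push_tangent v Ux; rewrite metricG2_ge0// andbT.
apply/negP => /eqP /(metricG2_eq0 aP) p0.
by move/eqP: v0; apply; apply: (F_imm Ux).
Qed.

Lemma push2_adj x v w : U x -> adjmx (push2 x v w) = push2 x v w.
Proof.
move=> Ux; rewrite /push2 adjmx_sum; apply: eq_bigr => i _.
rewrite adjmxZ conjc_real adjmx_sum; congr (_ *: _); apply: eq_bigr => j _.
by rewrite adjmxZ conjc_real ddF_adj.
Qed.

Lemma push2_sym x v w : U x -> push2 x v w = push2 x w v.
Proof.
move=> Ux; rewrite /push2; under eq_bigr do rewrite scaler_sumr.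
rewrite exchange_big; apply: eq_bigr => j _ /=; rewrite scaler_sumr.
by apply: eq_bigr => i _; rewrite !scalerA mulrC ddF_sym.
Qed.

Lemma anticomm_push x v w : anticomm (push x v) (push x w) =
  \sum_i (v 0 i)%:C *: \sum_j (w 0 j)%:C *: anticomm (dF i x) (dF j x).
Proof.
rewrite /anticomm {1 4}/push mulmx_suml mulmx_sumr -big_split /=.
apply: eq_bigr => i _; rewrite -scalemxAl -scalemxAr -scalerDr.
congr (_ *: _); rewrite /push mulmx_suml mulmx_sumr -big_split /=.
by apply: eq_bigr => j _; rewrite -scalemxAl -scalemxAr -scalerDr.
Qed.

Lemma push2_decomp x v w : U x -> push2 x v w =
  push2 x v w *m F x + F x *m push2 x v w + anticomm (push x v) (push x w).
Proof.
move=> Ux; rewrite anticomm_push /push2 mulmx_suml mulmx_sumr -!big_split /=.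
apply: eq_bigr => i _; rewrite -scalemxAl -scalemxAr -!scalerDr; congr (_ *: _).
rewrite mulmx_suml mulmx_sumr -!big_split /=; apply: eq_bigr => j _.
rewrite -scalemxAl -scalemxAr -!scalerDr; congr (_ *: _).
exact: ddF_decomp.
Qed.

Lemma first_form_smooth i j : smooth_on U (fun x => g x i j).
Proof.
rewrite (_ : (fun x => _) = (fun x => metricG2 (dF i x) (dF j x))).
  exact: smooth_on_metricG2.
by apply/funext => x; rewrite mxE.
Qed.

Lemma first_form_unit x : U x -> g x \in unitmx.
Proof. by move=> /first_form_pos_def/pos_def_unit. Qed.

Lemma is_derive_first_form i j l x : U x ->
  is_derive x (delta_mx 0 i) (fun y => g y j l)
    (metricG2 (ddF i j x) (dF l x) + metricG2 (dF j x) (ddF i l x)).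
Proof.
move=> Ux; rewrite (_ : (fun x => _) = (fun x => metricG2 (dF j x) (dF l x))).
  by apply: is_derive_metricG2; apply: is_ddF.
by apply/funext => y; rewrite mxE.
Qed.

(** The induced connection is the tangential part of the flat derivative: by symmetry of [ddF], the
    three derivatives of the metric collapse to twice one term. *)
Lemma christoffelE i j k x : U x -> christoffel g i j k x =
  \sum_l invmx (g x) k l * metricG2 (ddF i j x) (dF l x).
Proof.
move=> Ux; rewrite /christoffel mulr_sumr; apply: eq_bigr => l _.
rewrite mulrCA; congr (_ * _).
have dg a b c : pderiv a (fun y => g y b c) x =
    metricG2 (ddF a b x) (dF c x) + metricG2 (dF b x) (ddF a c x).
  by have [_ <-] := is_derive_first_form a b c Ux.
rewrite !dg (ddF_sym j i Ux) (ddF_sym l i Ux) (ddF_sym l j Ux).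
rewrite (metricG2C (dF j x) (ddF i l x)).
have cancel (a b c : R) : 2^-1 * (a + b + (a + c) - (b + c)) = a by field.
exact: cancel.
Qed.

Lemma christoffel_smooth i j k : smooth_on U (christoffel g i j k).
Proof.
apply: (@smooth_on_eq _ _ _ U_open (fun x =>
  \sum_l invmx (g x) k l * metricG2 (ddF i j x) (dF l x))) => [x Ux|].
  exact/esym/christoffelE.
apply: smooth_on_sum => // l; apply: smooth_on_mul => //.
  by apply: smooth_on_invmx => // *; [exact: first_form_smooth|exact: first_form_unit].
by apply: smooth_on_metricG2 => //; apply: smooth_mx_pderiv.
Qed.

Lemma invmx_first_form_sym x k l : U x ->
  invmx (g x) k l = invmx (g x) l k.
Proof.
move=> Ux; have [gs _] := first_form_pos_def Ux.
by have /matrixP/(_ k l) := trmx_inv (g x); rewrite gs mxE.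
Qed.

Lemma christoffel_lower i j q x : U x ->
  \sum_k christoffel g i j k x * g x k q = metricG2 (ddF i j x) (dF q x).
Proof.
move=> Ux; pose a : 'rV[R]_n := \row_l metricG2 (ddF i j x) (dF l x).
have -> : metricG2 (ddF i j x) (dF q x) = (a *m invmx (g x) *m g x) 0 q.
  by rewrite mulmxKV ?first_form_unit// mxE.
rewrite [RHS]mxE; apply: eq_bigr => k _; rewrite christoffelE//; congr (_ * _).
rewrite [RHS]mxE; apply: eq_bigr => l _.
by rewrite [a _ _]mxE mulrC (invmx_first_form_sym l k Ux).
Qed.

(* The scalar product of the components of A and B orthogonal to the image of
   dF in the Euclidean space of Hermitian matrices. *)
Definition gauss_form x (A B : 'M[C]_N) : R :=
  metricG2 A B -
  \sum_l \sum_p invmx (g x) l p * metricG2 A (dF p x) * metricG2 (dF l x) B.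

Lemma gauss_form_christoffel i j B x : U x ->
  gauss_form x (ddF i j x) B =
  metricG2 (ddF i j x) B -
  \sum_l christoffel g i j l x * metricG2 (dF l x) B.
Proof.
move=> Ux; congr (_ - _); apply: eq_bigr => l _.
by rewrite christoffelE// mulr_suml.
Qed.

(** [christoffel_lower] differentiated by the Leibniz rule. Working with lowered indices avoids any
    formula for the derivative of [invmx g]. *)
Let christoffel_derive i j k q x : U x ->
  \sum_l pderiv i (christoffel g j k l) x * g x l q +
  (\sum_l christoffel g j k l x * metricG2 (ddF i l x) (dF q x) +
   \sum_l christoffel g j k l x * metricG2 (dF l x) (ddF i q x)) =
  metricG2 (pderiv_mx i (ddF j k) x) (dF q x) +
  metricG2 (ddF j k x) (ddF i q x).
Proof.
move=> Ux; have dl l : is_derive x (delta_mx 0 i)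
    (fun y => christoffel g j k l y * g y l q)
    (christoffel g j k l x *: (metricG2 (ddF i l x) (dF q x) +
       metricG2 (dF l x) (ddF i q x)) +
     g x l q *: pderiv i (christoffel g j k l) x).
  apply: is_deriveM; last exact: is_derive_first_form.
  exact: smooth_on_derive (christoffel_smooth j k l) Ux.
have [_ dL] := is_derive_sumr (index_enum 'I_n) dl.
have dd : is_pderiv_mx i (ddF j k) x (pderiv_mx i (ddF j k) x).
  by apply: smooth_is_pderiv_mx Ux; apply: smooth_mx_pderiv.
have [_ dR] := is_derive_metricG2 dd (is_ddF i q Ux).
rewrite -dR -!big_split /=.
transitivity (\sum_l (christoffel g j k l x *: (metricG2 (ddF i l x) (dF q x) +
       metricG2 (dF l x) (ddF i q x)) +
     g x l q *: pderiv i (christoffel g j k l) x)).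
  have leibniz (a b c p d : R) : d * p + (a * b + a * c) = a *: (b + c) + p *: d.
    by rewrite /GRing.scale /=; ring.
  by apply: eq_bigr => l _; apply: leibniz.
rewrite -dL; apply: near_eq_derive; apply: (nbhs_open_eq U_open) => // y Uy.
exact: christoffel_lower.
Qed.

(** The Gauss equation in flat space. In the difference over [i] and [j] the third derivatives of
    [F] cancel ([e3]), and the quadratic Christoffel terms cancel the first correction in
    [christoffel_derive] ([quad]). *)
Lemma riemann_lower i j k q x : U x ->
  \sum_l riemann g i j k l x * g x l q =
  gauss_form x (ddF j k x) (ddF i q x) - gauss_form x (ddF i k x) (ddF j q x).
Proof.
have combine (L b1 b2 A1 A2 p1 p2 q1 q2 s1 s2 T T' c1 c2 : R) :
    L = A1 - A2 + (s1 - s2) -> s1 = p1 -> s2 = p2 ->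
    b1 = c1 - q1 -> b2 = c2 - q2 -> T = T' ->
    A1 + (p1 + q1) = T + c1 -> A2 + (p2 + q2) = T' + c2 -> L = b1 - b2.
  by move=> -> -> -> -> -> -> ? ?; lra.
move=> Ux; have g1 := gauss_form_christoffel j k (ddF i q x) Ux.
have g2 := gauss_form_christoffel i k (ddF j q x) Ux.
have e1 := christoffel_derive i j k q Ux; have e2 := christoffel_derive j i k q Ux.
have e3 : metricG2 (pderiv_mx i (ddF j k) x) (dF q x) =
          metricG2 (pderiv_mx j (ddF i k) x) (dF q x).
  have sw : pderiv_mx i (ddF j k) x = pderiv_mx j (ddF i k) x.
    exact: pderiv_mx_comm (dF_smooth k) Ux.
  exact: (f_equal (fun A => metricG2 A (dF q x)) sw).
have quad a b : \sum_l (\sum_s christoffel g a k s x * christoffel g b s l x) * g x l q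
    = \sum_s christoffel g a k s x * metricG2 (ddF b s x) (dF q x).
  under eq_bigr do rewrite mulr_suml; rewrite exchange_big /=.
  apply: eq_bigr => s _; rewrite -(christoffel_lower b s q Ux) mulr_sumr.
  by apply: eq_bigr => l _; rewrite mulrA.
have e4 : \sum_l riemann g i j k l x * g x l q =
    \sum_l pderiv i (christoffel g j k l) x * g x l q -
    \sum_l pderiv j (christoffel g i k l) x * g x l q +
    (\sum_l (\sum_s christoffel g j k s x * christoffel g i s l x) * g x l q -
     \sum_l (\sum_s christoffel g i k s x * christoffel g j s l x) * g x l q).
  rewrite -!sumrB -big_split /=; apply: eq_bigr => l _.
  by rewrite -!mulrBl -mulrDl -sumrB.
exact: combine e4 (quad j i) (quad i j) g1 g2 e3 e1 e2.
Qed.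

Lemma gauss_form_suml x I (s : seq I) (c : I -> R) (A : I -> 'M[C]_N) B :
  gauss_form x (\sum_(i <- s) (c i)%:C *: A i) B =
  \sum_(i <- s) c i * gauss_form x (A i) B.
Proof.
have perm4 (a b p q : R) : a * (b * p) * q = b * (a * p * q) by ring.
rewrite /gauss_form metricG2_suml (eq_bigr _ (fun i _ => metricG2Zl _ _ _)).
under [RHS]eq_bigr do rewrite mulrBr; rewrite [RHS]sumrB; congr (_ - _).
under [RHS]eq_bigr do rewrite mulr_sumr; rewrite [RHS]exchange_big.
apply: eq_bigr => l _.
under [RHS]eq_bigr do rewrite mulr_sumr; rewrite [RHS]exchange_big.
apply: eq_bigr => p _; rewrite metricG2_suml (eq_bigr _ (fun i _ => metricG2Zl _ _ _)).
rewrite mulr_sumr mulr_suml; apply: eq_bigr => i _.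
exact: perm4.
Qed.

Lemma gauss_form_sumr x I (s : seq I) (c : I -> R) A (B : I -> 'M[C]_N) :
  gauss_form x A (\sum_(i <- s) (c i)%:C *: B i) =
  \sum_(i <- s) c i * gauss_form x A (B i).
Proof.
rewrite /gauss_form metricG2_sumr (eq_bigr _ (fun i _ => metricG2Zr _ _ _)).
under [RHS]eq_bigr do rewrite mulrBr; rewrite [RHS]sumrB; congr (_ - _).
under [RHS]eq_bigr do rewrite mulr_sumr; rewrite [RHS]exchange_big.
apply: eq_bigr => l _.
under [RHS]eq_bigr do rewrite mulr_sumr; rewrite [RHS]exchange_big.
apply: eq_bigr => p _; rewrite metricG2_sumr (eq_bigr _ (fun i _ => metricG2Zr _ _ _)).
by rewrite mulr_sumr; apply: eq_bigr => i _; rewrite mulrCA.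
Qed.

Lemma gauss_form_push2 x X Y Z W :
  gauss_form x (push2 x Y Z) (push2 x X W) =
  \sum_i \sum_j \sum_k \sum_q
    X 0 i * Y 0 j * Z 0 k * W 0 q * gauss_form x (ddF j k x) (ddF i q x).
Proof.
rewrite [push2 x X W]/push2 gauss_form_sumr; apply: eq_bigr => i _.
rewrite [push2 x Y Z]/push2 gauss_form_suml mulr_sumr; apply: eq_bigr => j _.
rewrite gauss_form_suml !mulr_sumr; apply: eq_bigr => k _.
rewrite gauss_form_sumr !mulr_sumr; apply: eq_bigr => q _.
by rewrite !mulrA.
Qed.

Lemma riemann4E x X Y Z W : U x -> riemann4 g x X Y Z W =
  gauss_form x (push2 x Y Z) (push2 x X W) - gauss_form x (push2 x X Z) (push2 x Y W).
Proof.
have perm4 (a b c d : R) : a * b * c * d = a * d * (b * c) by ring.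
move=> Ux; rewrite !gauss_form_push2 [X in _ - X]exchange_big -sumrB.
apply: eq_bigr => i _; rewrite -sumrB; apply: eq_bigr => j _.
rewrite -sumrB; apply: eq_bigr => k _; rewrite -sumrB exchange_big.
apply: eq_bigr => q _ /=; rewrite [Y 0 j * X 0 i]mulrC -mulrBr.
have <- := riemann_lower i j k q Ux.
by rewrite mulr_sumr; apply: eq_bigr => l _; apply: perm4.
Qed.

(** * The Gauss equation of a hypersurface of the Grassmannian *)

Section UnitNormal.
Variables (e : V -> 'M[C]_N) (x : V) (E : 'M[R]_n).
Hypotheses (Ux : U x) (nN : (n + 9 = 4 * N)%N).
Hypotheses (e_normal : normal_at F x (e x)) (e_unit : metricG2 (e x) (e x) = 1).
Hypothesis E_orth : orthonormal (g x) E.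

Lemma push_frame : tangent_frame (F x) (fun a => push x (row a E)).
Proof.
split => [a|a b]; first exact: push_tangent.
rewrite first_form_push -row_mul; have /matrixP/(_ a b) := E_orth.
rewrite [RHS]mxE => <-; rewrite [LHS]mxE [RHS]mxE; apply: eq_bigr => l _.
by rewrite [row a _ _ _]mxE [(row b E)^T _ _]mxE [row b E _ _]mxE [E^T _ _]mxE.
Qed.

Lemma normal_push v : metricG2 (e x) (push x v) = 0.
Proof.
by rewrite metricG2_push big1// => i _; have [_ ->] := e_normal; rewrite mulr0.
Qed.

(** The frame and [e] are complete in the tangent space of [G_2], so the part orthogonal to [M]
    splits into the part orthogonal to [G_2] and the component along [e]. *)
Lemma gauss_form_normal A B : adjmx A = A -> adjmx B = B ->
  gauss_form x A B =
  metricG2 A B - metricG2 (projG2 (F x) A) B + metricG2 A (e x) * metricG2 B (e x).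
Proof.
move=> aA aB; have [te _] := e_normal.
rewrite (hypersurface_complete (F_G2 x) push_frame te e_unit
  (fun a => normal_push _) nN aA aB).
have cancel (p q r : R) : p - (q + r) + q = p - r by ring.
rewrite cancel /gauss_form; congr (_ - _).
transitivity (\sum_l \sum_p \sum_a
    E a p * metricG2 A (dF p x) * (E a l * metricG2 B (dF l x))).
  apply: eq_bigr => l _; apply: eq_bigr => p _.
  rewrite -(orthonormal_full (first_form_pos_def Ux) E_orth) mxE !mulr_suml.
  apply: eq_bigr => a _; rewrite [E^T _ _]mxE (metricG2C (dF l x) B).
  have perm4 (b c d f : R) : b * c * d * f = c * d * (b * f) by ring.
  exact: perm4.
under eq_bigr do rewrite exchange_big.
rewrite exchange_big; apply: eq_bigr => a _ /=; rewrite !metricG2_push mulr_sumr.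
apply: eq_bigr => l _; rewrite mulr_suml; apply: eq_bigr => p _.
by rewrite ![row a E _ _]mxE.
Qed.

(** The first term is the second fundamental form of [G_2] in flat space, with its reflection
    removed; the second is that of [M] in [G_2]. *)
Lemma gauss_form_push2_normal v w v' w' :
  gauss_form x (push2 x v w) (push2 x v' w') =
  metricG2 (anticomm (push x v) (push x w)) (anticomm (push x v') (push x w')) +
  metricG2 (push2 x v w) (e x) * metricG2 (push2 x v' w') (e x).
Proof.
have [aP PP rP] := F_G2 x.
have nP a b : push2 x a b - projG2 (F x) (push2 x a b) =
    (1%:M - F x - F x) *m anticomm (push x a) (push x b).
  by apply: second_derivative_normal (push2_decomp a b Ux) => //; apply: push_tangent.
have cP a b : F x *m anticomm (push x a) (push x b) =
              anticomm (push x a) (push x b) *m F x.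
  have [[_ ta] [_ tb]] := (push_tangent a Ux, push_tangent b Ux).
  by rewrite /anticomm mulmxDr mulmxDl !tangentG2_comm2.
rewrite gauss_form_normal; [|exact: push2_adj|exact: push2_adj]; congr (_ + _).
rewrite -(metricG2_reflect PP (cP v w) (cP v' w')) -!nP.
move: (push2 x v w) (push2 x v' w') => A B.
rewrite metricG2Dr metricG2Nr (metricG2Dl _ _ (projG2 _ B)) metricG2Nl.
rewrite metricG2Dl metricG2Nl -(metricG2_proj _ A B) -[in X in - (_ - X)]metricG2_proj.
by rewrite (projG2_idem (F_G2 x)) subrr subr0.
Qed.

Lemma second_form_mxE i j :
  second_form_mx F e x i j = metricG2 (ddF i j x) (e x).
Proof.
have [te _] := e_normal; have pe := tangentG2_proj (F_G2 x) te.
by rewrite mxE metricG2Zl e_unit mulr1 metricG2_proj pe.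
Qed.

Lemma second_form_push2 v w :
  metricG2 (push2 x v w) (e x) = (v *m second_form_mx F e x *m w^T) 0 0.
Proof.
rewrite /push2 metricG2_suml mxE.
under eq_bigr => i _ do rewrite metricG2Zl metricG2_suml mulr_sumr.
rewrite exchange_big; apply: eq_bigr => j _ /=; rewrite [w^T _ _]mxE.
rewrite [(v *m _) _ _]mxE mulr_suml; apply: eq_bigr => i _.
by rewrite second_form_mxE metricG2Zl -mulrA; congr (_ * _); rewrite mulrC.
Qed.

Lemma second_form_sym : (second_form_mx F e x)^T = second_form_mx F e x.
Proof.
apply/matrixP => i j; rewrite [LHS]mxE (second_form_mxE j i) (second_form_mxE i j).
exact: (f_equal (fun A => metricG2 A (e x)) (ddF_sym j i Ux)).
Qed.

Lemma sectionalE v w : let h a b := metricG2 (push2 x a b) (e x) in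
  sectional g x v w =
  curvG2 (push x v) (push x w) + (h v v * h w w - h v w ^+ 2).
Proof.
rewrite /= /sectional riemann4E// !gauss_form_push2_normal -curvG2_anticomm.
rewrite (push2_sym w v Ux) [X in X + _ - _]metricG2C.
move: (metricG2 (anticomm _ _) _) (metricG2 (anticomm _ _) _) => p q.
move: (metricG2 _ _) (metricG2 _ _) (metricG2 _ _) => a b c.
by ring.
Qed.

Lemma scalar_curvatureE : 2 * scalar_curvature g x E =
  (n%:R - 1) * (n%:R + 9) + extrinsic_scalar (g x) (second_form_mx F e x).
Proof.
pose h a b := metricG2 (push2 x (row a E) (row b E)) (e x).
pose K a b := sectional g x (row a E) (row b E).
have Ksym a b : K a b = K b a.
  rewrite /K !sectionalE curvG2C (push2_sym (row a E) (row b E) Ux).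
  by rewrite [X in _ + (X - _) = _]mulrC.
have Kdiag a : K a a = 0 by rewrite /K sectionalE curvG2xx expr2 subrr addr0.
have -> : 2 * scalar_curvature g x E = \sum_a \sum_b K a b.
  by rewrite (sum_offdiag Ksym Kdiag).
have <- := sum_curvG2 (F_G2 x) push_frame e_normal.1 e_unit
  (fun a => normal_push _) nN.
rewrite /extrinsic_scalar.
have EW := orthonormal_full (first_form_pos_def Ux) E_orth.
rewrite -(mxtrace_frame _ EW) -(normsq_frame second_form_sym EW).
have hE a b : (E *m second_form_mx F e x *m E^T) a b = h a b.
  rewrite /h second_form_push2 -row_mul [LHS]mxE [RHS]mxE; apply: eq_bigr => l _.
  by rewrite [row a _ _ _]mxE [(row b E)^T _ _]mxE [row b E _ _]mxE [E^T _ _]mxE.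
have -> : \tr (E *m second_form_mx F e x *m E^T) = \sum_a h a a.
  by apply: eq_bigr => a _.
have -> : normsq (E *m second_form_mx F e x *m E^T) = \sum_a \sum_b h a b ^+ 2.
  by apply: eq_bigr => a _; apply: eq_bigr => b _; rewrite hE.
rewrite expr2 mulr_suml -sumrB -big_split /=; apply: eq_bigr => a _.
rewrite mulr_sumr -sumrB -big_split /=; apply: eq_bigr => b _.
by rewrite /K sectionalE.
Qed.

End UnitNormal.
End LocalGeometry.

(** * Normal vector fields *)

Lemma pderiv_eq (R : realType) n (U : set 'rV[R]_n) (f g : 'rV[R]_n -> R) i x :
  open U -> (forall y, U y -> f y = g y) -> U x -> pderiv i f x = pderiv i g x.
Proof. by move=> oU fg Ux; apply: near_eq_derive; apply: nbhs_open_eq fg Ux. Qed.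

Section NormalFields.
Context {R : realType} {n N : nat}.
Local Notation C := R[i].
Local Notation V := 'rV[R]_n.
Variables (U : set V) (F : V -> 'M[C]_N).
Hypotheses (U_open : open U) (F_smooth : smooth_mx_on U F).
Hypotheses (F_G2 : forall x, G2 (F x)).
Hypothesis F_imm : forall x, U x -> immersion_at F x.
Hypothesis nN : (n + 9 = 4 * N)%N.

Local Notation dF i := (pderiv_mx i F).
Local Notation g := (first_form F).

(** The difference of the two sides is orthogonal to [e] and to a tangent frame of [M], which
    together are complete; so its norm is zero. *)
Lemma normal_line (e : V -> 'M[C]_N) x xi : U x ->
  normal_at F x (e x) -> metricG2 (e x) (e x) = 1 -> normal_at F x xi ->
  xi = (metricG2 xi (e x))%:C *: e x.
Proof.
move=> Ux ne e1 [txi nxi]; have [te _] := ne.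
have [E oE] := orthonormal_exists (first_form_pos_def F_smooth F_G2 F_imm Ux) (leqnn n).
have fE := push_frame F_smooth F_G2 Ux oE.
set c := metricG2 xi (e x).
have aD : adjmx (xi - c%:C *: e x) = xi - c%:C *: e x.
  by rewrite adjmxD adjmxN adjmxZ conjc_real (tangentG2_adj txi) (tangentG2_adj te).
apply/eqP; rewrite -subr_eq0; apply/eqP/(metricG2_eq0 aD).
have := hypersurface_complete (F_G2 x) fE te e1 (fun a => normal_push ne _) nN aD aD.
rewrite projG2D -scaleN1r scalerA !projG2Z (tangentG2_proj (F_G2 x) txi).
rewrite (tangentG2_proj (F_G2 x) te) -scalerA scaleN1r => ->.
rewrite metricG2Dl metricG2Nl metricG2Zl e1 mulr1 subrr mul0r add0r.
apply: big1 => a _; rewrite metricG2_push big1 ?mul0r// => i _.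
rewrite metricG2Dl metricG2Nl metricG2Zl; have [_ ->] := ne.
by rewrite nxi mulr0 subr0 mulr0.
Qed.

(* The component of a fixed matrix A that is tangent to G_2 and normal to F. *)
Definition normal_field (A : 'M[C]_N) (x : V) : 'M[C]_N :=
  projG2 (F x) A -
  \sum_l (\sum_k invmx (g x) l k * metricG2 A (dF k x))%:C *: dF l x.

Lemma normal_field_smooth A : smooth_mx_on U (normal_field A).
Proof.
have sdF i : smooth_mx_on U (dF i) by exact: smooth_mx_pderiv.
have sA : smooth_mx_on U (fun=> A) by exact: smooth_mx_cst.
have s1 : smooth_mx_on U (fun=> 1%:M : 'M[C]_N) by exact: smooth_mx_cst.
have sQ : smooth_mx_on U (fun x => 1%:M - F x) by exact: smooth_mx_sub.
apply: smooth_mx_sub => //.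
  by apply: smooth_mx_add => //; do 2!apply: smooth_mx_mul => //.
apply: smooth_mx_sum => // l; apply: smooth_mx_scale => //.
apply: smooth_on_sum => // k; apply: smooth_on_mul => //.
  apply: smooth_on_invmx => // *; first exact: first_form_smooth.
  exact: first_form_unit.
exact: smooth_on_metricG2.
Qed.

Lemma normal_field_normal A x : adjmx A = A -> U x ->
  normal_at F x (normal_field A x).
Proof.
move=> aA Ux; have tdF i := dF_tangent F_smooth F_G2 i Ux; split.
  apply/(tangentG2_projP (F_G2 x)); split.
    rewrite adjmxD adjmxN (projG2_adj (F_G2 x)) aA adjmx_sum; congr (_ - _).
    by apply: eq_bigr => l _; rewrite adjmxZ conjc_real (tangentG2_adj (tdF l)).
  rewrite projG2D -scaleN1r projG2Z scaleN1r (projG2_idem (F_G2 x)); congr (_ - _).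
  elim/big_ind: (X in projG2 _ X = X) => [|X Y IX IY|l _].
  - by rewrite -(scale0r (0 : 'M[C]_N)) projG2Z !scale0r.
  - by rewrite projG2D IX IY.
  - by rewrite projG2Z (tangentG2_proj (F_G2 x) (tdF l)).
move=> j; rewrite metricG2Dl metricG2Nl metricG2_suml metricG2_proj.
rewrite (tangentG2_proj (F_G2 x) (tdF j)).
have ug := first_form_unit F_smooth F_G2 F_imm Ux.
pose a : 'rV[R]_n := \row_l metricG2 A (dF l x).
have -> : metricG2 A (dF j x) = (a *m invmx (g x) *m g x) 0 j.
  by rewrite mulmxKV// mxE.
rewrite mxE -sumrB; apply: big1 => l _; rewrite metricG2Zl [g x l j]mxE.
rewrite -mulrBl [X in (X - _) * _]mxE -sumrB big1 ?mul0r// => k _.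
rewrite [a _ _]mxE (invmx_first_form_sym F_smooth F_G2 F_imm k l Ux).
by rewrite mulrC subrr.
Qed.

(** The formula with [invmx g] is visibly smooth in the point; in a frame it becomes a frame defect,
    to which the trace argument for nonvanishing applies. *)
Lemma normal_field_defect A x (E : 'M[R]_n) : adjmx A = A -> U x ->
  orthonormal (g x) E ->
  normal_field A x = frame_defect (F x) (fun a => push F x (row a E)) A.
Proof.
move=> aA Ux oE; congr (_ - _); rewrite /frame_part.
have tdF i := dF_tangent F_smooth F_G2 i Ux.
have tp a := push_tangent F_smooth F_G2 (row a E) Ux.
transitivity (\sum_a (metricG2 A (push F x (row a E)))%:C *: push F x (row a E)).
  under [RHS]eq_bigr do rewrite [X in _ *: X]/push scaler_sumr.
  rewrite [RHS]exchange_big; apply: eq_bigr => l _.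
  under [RHS]eq_bigr do rewrite scalerA -rmorphM; rewrite -scaler_suml -rmorph_sum.
  congr (_%:C *: _).
  under [RHS]eq_bigr do rewrite metricG2_push mulr_suml; rewrite [RHS]exchange_big.
  apply: eq_bigr => k _ /=.
  rewrite -(orthonormal_full (first_form_pos_def F_smooth F_G2 F_imm Ux) oE).
  rewrite mxE mulr_suml; apply: eq_bigr => a _.
  rewrite [E^T _ _]mxE ![row a E _ _]mxE.
  by rewrite mulrC mulrA mulrAC (mulrC (metricG2 _ _)).
apply: eq_bigr => a _; congr (_ *: _).
rewrite metricG2E ?(tangentG2_adj (tp a))// metricG2C.
by rewrite [in RHS]rmorphM rmorph_nat [RHS]mulrC mulKf// pnatr_eq0.
Qed.

Lemma local_unit_normal x : U x -> exists W e,
  [/\ open W, W `<=` U, W x & unit_normal_on F W e].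
Proof.
move=> Ux.
have [E oE] := orthonormal_exists (first_form_pos_def F_smooth F_G2 F_imm Ux) (leqnn n).
have fE := push_frame F_smooth F_G2 Ux oE.
(* The [n] vectors of a tangent frame of [M] are one short of [4 (N - 2)]. *)
have [|A [aA A0]] := frame_incomplete (F_G2 x) fE; first by rewrite -nN ltn_add2l.
rewrite -normal_field_defect// in A0.
pose q y := metricG2 (normal_field A y) (normal_field A y).
have sq : smooth_on U q by apply: smooth_on_metricG2 => //; apply: normal_field_smooth.
pose W := U `&` [set y | 0 < q y].
have Woqp : open W.
  rewrite openE => y [Uy qy]; apply: filterI; first exact: open_nbhs_nbhs.
  have cq : {for y, continuous q} by exact: smooth_on_continuous Uy.
  have cqy : q @ y --> q y by exact: cq.
  exact: cvgr_gt cqy _ qy.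
have WU : W `<=` U by move=> y [].
exists W, (fun y => ((Num.sqrt (q y))^-1)%:C *: normal_field A y); split => //.
  split => //=; have aN := tangentG2_adj (normal_field_normal aA Ux).1.
  rewrite lt0r metricG2_ge0// andbT.
  by apply: contra A0 => /eqP /(metricG2_eq0 aN) ->.
have sqW : smooth_on W q by move=> k; exact: Ck_subset (sq k).
have sqr0 y : W y -> Num.sqrt (q y) != 0 by move=> [_ qy]; rewrite gt_eqF// sqrtr_gt0.
split.
  apply: smooth_mx_scale => //; last exact: smooth_mx_subset (normal_field_smooth A).
  by apply: smooth_on_inv => //; apply: smooth_on_sqrt => // y [].
move=> y Wy; have Uy := WU y Wy; have [[aN tN] nN'] := normal_field_normal aA Uy.
split; last first.
  rewrite metricG2Zl metricG2Zr mulrA -invfM -expr2 sqr_sqrtr ?mulVf//.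
    by rewrite gt_eqF//; case: Wy.
  by rewrite ltW//; case: Wy.
split; last by move=> i; rewrite metricG2Zl nN' mulr0.
split; first by rewrite adjmxZ conjc_real aN.
by rewrite -scalemxAr -scalemxAl -scalerDr -tN.
Qed.

Lemma normal_at_unit_unique (e e' : V -> 'M[C]_N) x : U x ->
  normal_at F x (e x) -> metricG2 (e x) (e x) = 1 ->
  normal_at F x (e' x) -> metricG2 (e' x) (e' x) = 1 ->
  exists2 c : R, c ^+ 2 = 1 & second_form_mx F e' x = c *: second_form_mx F e x.
Proof.
move=> Ux ne e1 ne' e1'; have ee' := normal_line Ux ne e1 ne'.
exists (metricG2 (e' x) (e x)).
  by move: e1'; rewrite {1 2}ee' metricG2Zl metricG2Zr e1 mulr1 expr2.
apply/matrixP => i j; rewrite [RHS]mxE.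
rewrite (second_form_mxE F_G2 ne' e1') (second_form_mxE F_G2 ne e1).
by rewrite {1}ee' metricG2Zr.
Qed.

(** * Flatness of the normal connection *)

Section NormalConnection.
Variable e : V -> 'M[C]_N.
Hypothesis e_normal : unit_normal_on F U e.

(** Differentiating [g(e, e) = 1] shows that [e] is parallel, so the connection just differentiates
    the coefficient along [e]. *)
Lemma normal_connE i xi x : smooth_mx_on U xi ->
  (forall y, U y -> normal_at F y (xi y)) -> U x ->
  normal_conn F e i xi x =
  (pderiv i (fun y => metricG2 (xi y) (e y)) x)%:C *: e x.
Proof.
move=> sxi nxi Ux; have [se ne] := e_normal; have [[te _] e1] := ne x Ux.
rewrite /normal_conn /normal_part /covG2 metricG2_proj (tangentG2_proj (F_G2 x) te).
congr (_%:C *: _).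
have de := smooth_is_pderiv_mx i se Ux; have dxi := smooth_is_pderiv_mx i sxi Ux.
have [_ dphi] := is_derive_metricG2 dxi de; rewrite /pderiv dphi.
have [_] := is_derive_metricG2 de de.
rewrite (_ : derive _ _ _ = 0) => [/esym/eqP|]; last first.
  rewrite -(derive_cst (1 : R) x (delta_mx 0 i : V)); apply: near_eq_derive.
  by apply: (nbhs_open_eq U_open) => // y Uy; have [] := ne y Uy.
rewrite (metricG2C (e x)) -mulr2n mulrn_eq0 /= => /eqP de0.
have [nex _] := ne x Ux; rewrite [in X in _ + X](normal_line Ux nex e1 (nxi x Ux)).
by rewrite metricG2Zl (metricG2C (e x)) de0 mulr0 addr0.
Qed.

(** With the parallel section [e], commutation reduces to the symmetry of the second derivatives of
    the coefficient [phi]. *)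
Lemma normal_conn_comm i j xi x : smooth_mx_on U xi ->
  (forall y, U y -> normal_at F y (xi y)) -> U x ->
  normal_conn F e i (normal_conn F e j xi) x =
  normal_conn F e j (normal_conn F e i xi) x.
Proof.
move=> sxi nxi Ux; have [se ne] := e_normal.
pose phi y := metricG2 (xi y) (e y).
have sphi : smooth_on U phi by exact: smooth_on_metricG2.
have DD a b : normal_conn F e a (normal_conn F e b xi) x =
    (pderiv a (pderiv b phi) x)%:C *: e x.
  pose eta y := (pderiv b phi y)%:C *: e y.
  have seta : smooth_mx_on U eta.
    by apply: smooth_mx_scale => //; apply: smooth_on_pderiv.
  have neta y : U y -> normal_at F y (eta y).
    move=> Uy; have [[[ae te] pe] _] := ne y Uy; split; last first.
      by move=> k; rewrite metricG2Zl pe mulr0.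
    split; first by rewrite adjmxZ conjc_real ae.
    by rewrite -scalemxAr -scalemxAl -scalerDr -te.
  have d_eta : pderiv_mx a (normal_conn F e b xi) x = pderiv_mx a eta x.
    by apply: (pderiv_mx_eq U_open) => // y Uy; exact: normal_connE.
  have d_phi : pderiv a (fun y => metricG2 (eta y) (e y)) x =
      pderiv a (pderiv b phi) x.
    have eq_phi y : U y -> metricG2 (eta y) (e y) = pderiv b phi y.
      by move=> Uy; rewrite metricG2Zl; have [_ ->] := ne y Uy; rewrite mulr1.
    exact: (pderiv_eq a U_open eq_phi Ux).
  apply: etrans (f_equal (fun Z => normal_part e x (projG2 (F x) Z)) d_eta) _.
  apply: etrans (normal_connE a seta neta Ux) _.
  exact: (f_equal (fun c : R => c%:C *: e x) d_phi).
rewrite (DD i j) (DD j i).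
exact: (f_equal (fun c : R => c%:C *: e x) (pderiv_comm i j U_open sphi Ux)).
Qed.

End NormalConnection.
End NormalFields.

(** [shape - a] is conjugate to a multiple of a single elementary matrix, hence has rank at most 1,
    and its kernel is the eigenspace. *)
Lemma quasi_umbilical_of_shape_form (R : realType) (n N : nat)
    (F e : 'rV[R]_n -> 'M[R[i]]_N) (r : R) (x : 'rV[R]_n) (E : 'M[R]_n) :
  (0 < n)%N -> shape_form_in F e r x E ->
  quasi_umbilical_at F e x.
Proof.
move=> n0 [oE [a ES]]; exists a; rewrite /eigenspace mxrank_ker.
have uE : E \in unitmx.
  by rewrite -row_free_unit; apply: orthonormal_row_free oE.
suff r1 : (\rank (Defs.shape F e x - a%:M)%R <= 1)%N.
  by rewrite -subn1 leq_sub2l.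
have last_lt : (n.-1 < n)%N by rewrite prednK.
pose l := Ordinal last_lt; pose c := n%:R * (n%:R - 1) / r * a - a.
have -> : Defs.shape F e x - a%:M = invmx E *m (c *: delta_mx l l) *m E.
  apply: (can_inj (mulKmx uE)); rewrite -mulmxA mulKVmx//.
  rewrite mulmxBr ES mul_mx_scalar -mul_scalar_mx -mulmxBl; congr (_ *m _).
  apply/matrixP => i j; rewrite !mxE; have [->|ij] := eqVneq i j.
    rewrite andbb !mulr1n (_ : (j == l) = (j == n.-1 :> nat)) -?val_eqE//.
    by case: eqP => _; rewrite ?mulr1// mulr0 subrr.
  rewrite !mulr0n subr0 (_ : _ && _ = false) ?mulr0//.
  by apply/negP => /andP[/eqP il /eqP jl]; rewrite il jl eqxx in ij.
apply: leq_trans (mxrankM_maxl _ _) _; apply: leq_trans (mxrankM_maxr _ _) _.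
by apply: leq_trans (mxrank_scale _ _) _; rewrite mxrank_delta.
Qed.

(** * Real hypersurfaces *)

Section Hypersurfaces.
Context {R : realType} {m : nat} {M : topologicalType}.
Variable f : M -> 'M[R[i]]_(m + 2).
Hypotheses (m_gt0 : (0 < m)%N) (f_hyp : real_hypersurface f).

Local Notation n := (4 * m - 1)%N.
Implicit Types (U : set 'rV[R]_n) (phi : 'rV[R]_n -> M).

Let nN : (n + 9 = 4 * (m + 2))%N. Proof. by lia. Qed.
Let n_gt1 : (1 < n)%N. Proof. by lia. Qed.

Let f_G2 phi x : G2 ((f \o phi) x).
Proof. by have [_ _ fG _] := f_hyp; apply: fG. Qed.

Lemma local_param_subset U W phi : open W -> W `<=` U ->
  local_param f U phi -> local_param f W phi.
Proof.
move=> oW WU [oU phi_inj phi_c phi_open [sf imm]]; split => //.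
- move=> x y /set_mem/WU Ux /set_mem/WU Uy.
  by apply: phi_inj; apply: mem_set.
- by move=> x /WU; apply: phi_c.
- by move=> V oV VW; apply: phi_open => //; apply: subset_trans WU.
- split; first exact: smooth_mx_subset sf.
  by move=> x /WU; apply: imm.
Qed.

Lemma normalized_scalar_curvatureE U phi e x E : framed_param f U phi e -> U x ->
  orthonormal (first_form (f \o phi) x) E ->
  normalized_scalar_curvature (first_form (f \o phi)) x E =
  extrinsic_scalar (first_form (f \o phi) x) (second_form_mx (f \o phi) e x) /
    (n%:R * (n%:R - 1)) + (n%:R + 9) / n%:R.
Proof.
move=> [[oU _ _ _ [sf imm]] [_ ne]] Ux oE; have [nex e1] := ne x Ux.
rewrite /normalized_scalar_curvature.
rewrite (scalar_curvatureE oU sf (f_G2 phi) imm Ux nN nex e1 oE).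
have n0 : n%:R != 0 :> R by rewrite pnatr_eq0 -lt0n ltnW.
have n1 : n%:R - 1 != 0 :> R by rewrite subr_eq0 pnatr_eq1 gtn_eqF.
move: (extrinsic_scalar _ _) => c; move: (n%:R : R) n0 n1 => d d0 d1.
by field; rewrite d0 d1.
Qed.

(** * The case of equality *)

Section Equality.
Variables (r : R) (delta : 'M[R]_n -> 'M[R]_n -> 'M[R]_n -> R).
Hypothesis delta_eq : forall G H E, pos_def G -> H^T = H -> orthonormal G E ->
  extrinsic_scalar G H = delta G H E <->
  exists E' a, orthonormal G E' /\ principal_form G H r E' a.

(** [delta] stands for either Casorati curvature. Towards the shape form, [local_unit_normal]
    provides the normal field and the frame is chosen point by point; conversely, the given normal
    [e] is compared with the normal [e'] of the shape form. *)
Lemma equality_shape_form :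
  (forall U phi e, framed_param f U phi e -> forall x, U x ->
   let G := first_form (f \o phi) x in
   let H := second_form_mx (f \o phi) e x in
   forall E, orthonormal G E -> extrinsic_scalar G H = delta G H E) <->
  shape_form f r.
Proof.
split=> [eqd U phi lp x Ux|sh U phi e [lp [se ne]] x Ux G H E oE].
  have [oU _ _ _ [sf imm]] := lp.
  have [W [e [oW WU Wx ne]]] := local_unit_normal oU sf (f_G2 phi) imm nN Ux.
  exists W, e; split => // y Wy; have Uy := WU y Wy.
  have Gp := first_form_pos_def sf (f_G2 phi) imm Uy.
  have [ney e1] := ne.2 y Wy.
  have Hs := second_form_sym oU sf (f_G2 phi) Uy ney e1.
  have [E oE] := orthonormal_exists Gp (leqnn n).
  have /(delta_eq Gp Hs oE) [E' [a [oE' pE']]] :=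
    eqd W phi e (conj (local_param_subset oW WU lp) ne) y Wy E oE.
  by exists E'; split => //; exists a.
have [oU _ _ _ [sf imm]] := lp.
have Gp : pos_def G := first_form_pos_def sf (f_G2 phi) imm Ux.
have [nex e1] := ne x Ux.
have Hs : H^T = H := second_form_sym oU sf (f_G2 phi) Ux nex e1.
apply/(delta_eq Gp Hs oE).
have [W [e' [oW WU Wx ne' /(_ x Wx)[E' [oE' [a ES]]]]]] := sh U phi lp x Ux.
have [nex' e1'] := ne'.2 x Wx.
have [c c2 Hc] := normal_at_unit_unique sf (f_G2 phi) imm nN Ux nex e1 nex' e1'.
(* The normals [e] and [e'] differ by the sign [c]; every diagonal entry is proportional to [a], so
   replacing [a] by [c * a] accounts for it. *)
exists E', (c * a); split => //; rewrite /principal_form.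
have -> : H = c *: second_form_mx (f \o phi) e' x.
  by rewrite Hc scalerA -expr2 c2 scale1r.
rewrite -scalemxAl -scalemxAr; move: ES; rewrite /Defs.shape -/G => ->.
rewrite scalemxAl; congr (_ *m _); apply/matrixP => i j; rewrite !mxE.
by rewrite mulrnAr; congr (_ *+ _); case: ifP => // _; rewrite mulrCA.
Qed.

End Equality.

(** Quasi-umbilicity is read off the diagonal form, with the same local normal; flatness comes from
    the normal bundle having rank one. *)
Lemma shape_form_characterization r : shape_form f r <->
  [/\ invariantly_quasi_umbilical f, flat_normal_connection f & shape_form f r].
Proof.
split=> [sh|[_ _ sh]]; last exact: sh.
split; last exact: sh.
  move=> U phi lp x Ux; have [W [e [oW WU Wx ne sW]]] := sh U phi lp x Ux.
  exists W, e; split => // y /sW[E sE].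
  by apply: quasi_umbilical_of_shape_form sE; apply: ltnW.
move=> U phi e [[oU _ _ _ [sf imm]] ne] xi sxi nxi i j x Ux.
exact: (normal_conn_comm oU sf (f_G2 phi) imm nN ne i j sxi nxi Ux).
Qed.

End Hypersurfaces.

Theorem theorem3p1 (R : realType) (m : nat) (hm : (0 < m)%N)
    (M : topologicalType) (f : M -> 'M[R[i]]_(m + 2))
    (hM : real_hypersurface f) :
  let n : R := (4 * m - 1)%:R in
  (forall r : R, 0 < r -> r < n * (n - 1) ->
     at_every_point f r (fun rho delta _ =>
       rho <= delta / (n * (n - 1)) + (n + 9) / n) /\
     (at_every_point f r (fun rho delta _ =>
        rho = delta / (n * (n - 1)) + (n + 9) / n) <->
      [/\ invariantly_quasi_umbilical f, flat_normal_connection f &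
          shape_form f r])) /\
  (forall r : R, n * (n - 1) < r ->
     at_every_point f r (fun rho _ delta_hat =>
       rho <= delta_hat / (n * (n - 1)) + (n + 9) / n) /\
     (at_every_point f r (fun rho _ delta_hat =>
        rho = delta_hat / (n * (n - 1)) + (n + 9) / n) <->
      [/\ invariantly_quasi_umbilical f, flat_normal_connection f &
          shape_form f r])).
Proof.
move=> n; have n_gt1 : (1 < 4 * m - 1)%N by lia.
have n_pos : 0 < n * (n - 1).
  by rewrite mulr_gt0 ?subr_gt0 ?ltr1n// ltr0n ltnW.
have le_iff (a b c : R) : (a / (n * (n - 1)) + c <= b / (n * (n - 1)) + c) = (a <= b).
  by rewrite lerD2r ler_pM2r// invr_gt0.
have eq_iff (a b c : R) : a / (n * (n - 1)) + c = b / (n * (n - 1)) + c <-> a = b.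
  split=> [/addIr/mulIf|->//]; apply; by rewrite invr_eq0 gt_eqF.
have facts U phi e x : framed_param f U phi e -> U x ->
    pos_def (first_form (f \o phi) x) /\
    (second_form_mx (f \o phi) e x)^T = second_form_mx (f \o phi) e x.
  move=> [[oU _ _ _ [sf imm]] [_ ne]] Ux; have [nex e1] := ne x Ux.
  have fG y : G2 ((f \o phi) y) by have [_ _ fG _] := hM; apply: fG.
  split; first exact: first_form_pos_def imm _ Ux.
  exact: second_form_sym oU sf fG _ _ Ux nex e1.
split=> [r r0 rn|r rn].
  split=> [U phi e fr x Ux G H E oE|].
    have [Gp Hs] := facts _ _ _ _ fr Ux.
    rewrite (normalized_scalar_curvatureE hm hM fr Ux oE) le_iff.
    exact: extrinsic_scalar_le_delta.
  apply: iff_trans (shape_form_characterization hm hM r).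
  apply: iff_trans (equality_shape_form hm hM (delta := fun G H => delta_casorati G H r) _).
    split=> eqd U phi e fr x Ux G H E oE.
      have := eqd U phi e fr x Ux E oE.
      by rewrite (normalized_scalar_curvatureE hm hM fr Ux oE) => /eq_iff.
    rewrite (normalized_scalar_curvatureE hm hM fr Ux oE); apply/eq_iff.
    exact: (eqd U phi e fr x Ux E oE).
  by move=> G H E Gp Hs oE; apply: extrinsic_scalar_eq_delta.
have r0 : 0 < r := lt_trans n_pos rn.
split=> [U phi e fr x Ux G H E oE|].
  have [Gp Hs] := facts _ _ _ _ fr Ux.
  rewrite (normalized_scalar_curvatureE hm hM fr Ux oE) le_iff.
  exact: extrinsic_scalar_le_delta_hat.
apply: iff_trans (shape_form_characterization hm hM r).
apply: iff_trans (equality_shape_form hm hM (delta := fun G H => delta_hat_casorati G H r) _).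
  split=> eqd U phi e fr x Ux G H E oE.
    have := eqd U phi e fr x Ux E oE.
    by rewrite (normalized_scalar_curvatureE hm hM fr Ux oE) => /eq_iff.
  rewrite (normalized_scalar_curvatureE hm hM fr Ux oE); apply/eq_iff.
  exact: (eqd U phi e fr x Ux E oE).
by move=> G H E Gp Hs oE; apply: extrinsic_scalar_eq_delta_hat.
Qed.
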